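(* Let $X$ be a complex Banach space, $\alpha\ge1$, and $T\in\mathcal{B}(X)$ a $(C,\alpha)$-bounded operator with $\sigma(T)\cap\mathbb{T}\subseteq\{1\}$. Then $\|M_T^{\alpha-1}(n)\|=o(n)$ and $\|T^n\|=o(n^\alpha)$ as $n\to\infty$.
   Context: $\mathbb{T}$ is the unit circle in $\mathbb{C}$, $\sigma(T)$ the spectrum. For $\gamma\ge0$, $k^\gamma(n)=\frac{\Gamma(n+\gamma)}{\Gamma(\gamma)\Gamma(n+1)}$ for $\gamma>0$ and $k^0(n)=\delta_{n,0}$, $n\in\mathbb{N}_0$. For $\gamma\ge0$, $\Delta^{-\gamma}\mathcal{T}(n)=\sum_{j=0}^nk^\gamma(n-j)T^j$ and $M_T^\gamma(n)=\Delta^{-\gamma}\mathcal{T}(n)/k^{\gamma+1}(n)$ (so $M_T^0(n)=T^n$); $T$ is $(C,\gamma)$-bounded if $\sup_n\|M_T^\gamma(n)\|<\infty$. *)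

(* Defs.v *)
From Stdlib Require Import Reals.
Open Scope R_scope.

Definition Cx : Type := (R * R)%type.
Definition Cx0 : Cx := (0, 0).
Definition Cx1 : Cx := (1, 0).
Definition RtoC (r : R) : Cx := (r, 0).
Definition Cadd (z w : Cx) : Cx := (fst z + fst w, snd z + snd w).
Definition Cmul (z w : Cx) : Cx :=
  (fst z * fst w - snd z * snd w, fst z * snd w + snd z * fst w).
Definition Cmod (z : Cx) : R := sqrt (fst z * fst z + snd z * snd z).

Record CBanach : Type := {
  car :> Type;
  vzero : car;
  vadd : car -> car -> car;
  vopp : car -> car;
  vscal : Cx -> car -> car;
  vnorm : car -> R;
  vadd_assoc : forall x y z, vadd x (vadd y z) = vadd (vadd x y) z;
  vadd_comm : forall x y, vadd x y = vadd y x;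
  vadd_0 : forall x, vadd vzero x = x;
  vadd_opp : forall x, vadd x (vopp x) = vzero;
  vscal_addv : forall c x y, vscal c (vadd x y) = vadd (vscal c x) (vscal c y);
  vscal_addc : forall c d x, vscal (Cadd c d) x = vadd (vscal c x) (vscal d x);
  vscal_mul : forall c d x, vscal (Cmul c d) x = vscal c (vscal d x);
  vscal_1 : forall x, vscal Cx1 x = x;
  vnorm_eq0 : forall x, vnorm x = 0 -> x = vzero;
  vnorm_triangle : forall x y, vnorm (vadd x y) <= vnorm x + vnorm y;
  vnorm_scal : forall c x, vnorm (vscal c x) = Cmod c * vnorm x;
  vcomplete : forall u : nat -> car,
    (forall eps, 0 < eps -> exists N, forall m n, (N <= m)%nat -> (N <= n)%nat ->
        vnorm (vadd (u m) (vopp (u n))) < eps) ->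
    exists l, forall eps, 0 < eps -> exists N, forall n, (N <= n)%nat ->
        vnorm (vadd (u n) (vopp l)) < eps
}.

Section Ops.
Variable X : CBanach.

Definition opnorm_le (A : X -> X) (c : R) : Prop :=
  forall x : X, vnorm X (A x) <= c * vnorm X x.

Definition is_bounded_linear (A : X -> X) : Prop :=
  (forall x y, A (vadd X x y) = vadd X (A x) (A y)) /\
  (forall c x, A (vscal X c x) = vscal X c (A x)) /\
  (exists M, opnorm_le A M).

Definition invertible (A : X -> X) : Prop :=
  exists S : X -> X, is_bounded_linear S /\
    (forall x, S (A x) = x) /\ (forall x, A (S x) = x).

Definition in_spectrum (T : X -> X) (lam : Cx) : Prop :=
  ~ invertible (fun x => vadd X (vscal X lam x) (vopp X (T x))).

Fixpoint opow (T : X -> X) (n : nat) (x : X) : X :=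
  match n with O => x | S m => T (opow T m x) end.

Fixpoint vsum (f : nat -> X) (n : nat) : X :=
  match n with
  | O => f O
  | S m => vadd X (vsum f m) (f (S m))
  end.
End Ops.

(** k^gamma(n) = Gamma(n+gamma)/(Gamma(gamma) Gamma(n+1)) for gamma>0,
    k^0(n) = delta_{n,0}; both equal prod_{i=1}^n (gamma+i-1)/i. *)
Fixpoint kcoef (gamma : R) (n : nat) : R :=
  match n with
  | O => 1
  | S m => kcoef gamma m * ((gamma + INR m) / INR (S m))
  end.

Definition Mop (X : CBanach) (T : X -> X) (gamma : R) (n : nat) (x : X) : X :=
  vscal X (RtoC (/ kcoef (gamma + 1) n))
    (vsum X (fun j => vscal X (RtoC (kcoef gamma (n - j))) (opow X T j x)) n).

Definition Cesaro_bounded (X : CBanach) (T : X -> X) (gamma : R) : Prop :=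
  exists K, forall n, opnorm_le X (Mop X T gamma n) K.

(* Main.v *)
Require Import Defs.
From Stdlib Require Import Reals Lra Lia Classical ClassicalEpsilon.
From Coquelicot Require Complex Compactness.
Open Scope R_scope.

(** Write [S_g(n) = sum_(j <= n) k^g(n-j) T^j].  Since [S_a(n+1) = T S_a(n) + k^a(n+1)], for each fixed
    [N] the vectors [T^j S_a(n) x], [j <= 2N + 2], are bounded by a multiple of [k^(a+1)(n) |x|] that does
    not depend on [N] once [n] is large, and [S_(a-1)] is, up to lower order terms, the increment
    [(T - 1) T^N S_a(n)].  So the first claim follows from a finite Katznelson-Tzafriri estimate:
    if [|T^j y| <= B] for [j <= 2N + 2] then [|(T - 1) T^N y| <= eps B], for a suitable [N].

    For that estimate [T^N] is written as the sum of Fejer-type averages [H_w] over the [N]-th roots of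
    unity [w].  Away from [1] the resolvent is uniformly bounded by compactness, so
    [(T - w)^2 H_w = O(1/N^2)] makes the [N] terms together [O(1/N)].  Near [1] one has
    [(T - 1) H_w = (T - w) H_w + (w - 1) H_w]: the first parts add up to the length of the arc, and the
    second parts are combined, after smoothing the cut-off by averaging over rotations, into a
    polynomial in [T] whose coefficients are small in l^1 by Parseval's identity.

    The second claim is the inversion [T^n = sum_j k^(1-a)(j) S_(a-1)(n-j)] with [k^(1-a)] absolutely
    summable. *)

(** * Finite sums in commutative monoids *)

(** Real numbers, complex numbers and vectors share one notion of finite sum, so exchange and
    reindexing are proved once for all three. *)
Class CMonoid (V : Type) := {
  madd : V -> V -> V;
  mzero : V;
  madd_assoc : forall x y z, madd x (madd y z) = madd (madd x y) z;
  madd_comm : forall x y, madd x y = madd y x;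
  madd_0 : forall x, madd mzero x = x
}.

Fixpoint bsum {V} {M : CMonoid V} (f : nat -> V) (n : nat) : V :=
  match n with O => mzero | S m => madd (bsum f m) (f m) end.

Section BigSums.
Context {V : Type} {M : CMonoid V}.
Implicit Types f g : nat -> V.

Lemma madd_0r (x : V) : madd x mzero = x.
Proof. rewrite madd_comm. apply madd_0. Qed.

Lemma madd_swap (a b c d : V) :
  madd (madd a b) (madd c d) = madd (madd a c) (madd b d).
Proof.
  rewrite <- !madd_assoc. f_equal. rewrite !madd_assoc. f_equal. apply madd_comm.
Qed.

Lemma bsum_ext f g n :
  (forall i, (i < n)%nat -> f i = g i) -> bsum f n = bsum g n.
Proof.
  induction n; intros H; simpl; auto.
  rewrite IHn by (intros; apply H; lia). rewrite H by lia. reflexivity.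
Qed.

Lemma bsum_zero f n : (forall i, (i < n)%nat -> f i = mzero) -> bsum f n = mzero.
Proof.
  induction n; intros H; simpl; auto.
  rewrite IHn by (intros; apply H; lia). rewrite H by lia. apply madd_0.
Qed.

Lemma bsum_add f g n :
  bsum (fun i => madd (f i) (g i)) n = madd (bsum f n) (bsum g n).
Proof.
  induction n; simpl. { now rewrite madd_0. }
  rewrite IHn. apply madd_swap.
Qed.

Lemma bsum_exchange (h : nat -> nat -> V) n m :
  bsum (fun i => bsum (fun j => h i j) m) n =
  bsum (fun j => bsum (fun i => h i j) n) m.
Proof.
  induction n; simpl.
  - symmetry. apply bsum_zero. reflexivity.
  - rewrite IHn. symmetry. apply bsum_add.
Qed.

Lemma bsum_cat f n m :
  bsum f (n + m) = madd (bsum f n) (bsum (fun i => f (n + i)%nat) m).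
Proof.
  induction m; simpl.
  - rewrite Nat.add_0_r. now rewrite madd_0r.
  - rewrite Nat.add_succ_r. simpl. rewrite IHm. now rewrite madd_assoc.
Qed.

Lemma bsum_first f n : bsum f (S n) = madd (f O) (bsum (fun i => f (S i)) n).
Proof. change (S n) with (1 + n)%nat. rewrite bsum_cat. simpl. now rewrite madd_0. Qed.

Lemma bsum_rev f n : bsum f n = bsum (fun i => f (n - 1 - i)%nat) n.
Proof.
  induction n; auto.
  rewrite (bsum_first (fun i => f (S n - 1 - i)%nat)). simpl.
  rewrite IHn. rewrite madd_comm. f_equal.
  - f_equal. lia.
  - apply bsum_ext. intros. f_equal. lia.
Qed.

Lemma bsum_single f n k :
  (k < n)%nat -> (forall i, (i < n)%nat -> i <> k -> f i = mzero) ->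
  bsum f n = f k.
Proof.
  induction n; intros Hk H; simpl. { lia. }
  destruct (Nat.eq_dec k n) as [->|Hne].
  - rewrite bsum_zero. { apply madd_0. } intros; apply H; lia.
  - rewrite IHn by (try lia; intros; apply H; lia).
    rewrite (H n) by lia. apply madd_0r.
Qed.

(** Both sides run over i + j < n. The induction peels off the last antidiagonal, whose sum is
    unchanged by reversal. *)
Lemma bsum_triangle (h : nat -> nat -> V) n :
  bsum (fun i => bsum (fun j => h i j) (n - i)) n =
  bsum (fun j => bsum (fun i => h i j) (n - j)) n.
Proof.
  assert (step : forall h' : nat -> nat -> V, forall m,
    bsum (fun i => bsum (fun j => h' i j) (S m - i)) (S m) =
    madd (bsum (fun i => bsum (fun j => h' i j) (m - i)) m)
         (bsum (fun i => h' i (m - i)%nat) (S m))).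
  { intros h' m.
    rewrite (bsum_ext _ (fun i => madd (bsum (fun j => h' i j) (m - i)) (h' i (m - i)%nat))).
    2: { intros i Hi. replace (S m - i)%nat with (S (m - i)) by lia. reflexivity. }
    rewrite bsum_add. f_equal. simpl. rewrite Nat.sub_diag. apply madd_0r. }
  induction n; auto.
  rewrite step, (step (fun j i => h i j)). f_equal; auto.
  rewrite bsum_rev. apply bsum_ext. intros i Hi. f_equal; lia.
Qed.

Lemma bsum_morph {W} {M' : CMonoid W} (phi : V -> W) f n :
  phi mzero = mzero -> (forall x y, phi (madd x y) = madd (phi x) (phi y)) ->
  phi (bsum f n) = bsum (fun i => phi (f i)) n.
Proof.
  intros H0 H. induction n; simpl; auto. rewrite H, IHn. reflexivity.
Qed.

End BigSums.

#[export] Instance R_monoid : CMonoid R.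
Proof.
  refine {| madd := Rplus; mzero := 0 |}; intros; ring.
Defined.

Lemma rsum_le (f g : nat -> R) n :
  (forall i, (i < n)%nat -> f i <= g i) -> bsum f n <= bsum g n.
Proof.
  induction n; intros H; simpl. { lra. }
  apply Rplus_le_compat; auto.
Qed.

Lemma rsum_const (c : R) n : bsum (fun _ => c) n = INR n * c.
Proof. induction n; simpl bsum. { simpl; ring. } rewrite IHn, S_INR. simpl; ring. Qed.

Lemma rsum_bound (f : nat -> R) c n :
  (forall i, (i < n)%nat -> f i <= c) -> bsum f n <= INR n * c.
Proof. intros H. rewrite <- rsum_const. now apply rsum_le. Qed.

Lemma rsum_scal (c : R) (f : nat -> R) n :
  bsum (fun i => c * f i) n = c * bsum f n.
Proof.
  symmetry. apply (bsum_morph (fun x => c * x)); intros; simpl; ring.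
Qed.

Lemma rsum_add (f g : nat -> R) n :
  bsum (fun i => f i + g i) n = bsum f n + bsum g n.
Proof. exact (bsum_add f g n). Qed.

Lemma bsum_subadditive {V} {M : CMonoid V} (nu : V -> R) (f : nat -> V) n :
  nu mzero <= 0 -> (forall x y, nu (madd x y) <= nu x + nu y) ->
  nu (bsum f n) <= bsum (fun i => nu (f i)) n.
Proof.
  intros H0 H. induction n; simpl; auto.
  eapply Rle_trans. { apply H. } lra.
Qed.

(** * Complex numbers and roots of unity *)

Definition Copp (z : Cx) : Cx := (- fst z, - snd z).
Definition Csub (z w : Cx) : Cx := Cadd z (Copp w).
Definition Cconj (z : Cx) : Cx := (fst z, - snd z).
Definition cis (t : R) : Cx := (cos t, sin t).

Ltac cx_eq := intros;
  repeat match goal with z : Cx |- _ => destruct z end;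
  unfold Csub, Cadd, Copp, Cmul, Cconj, Cx0, Cx1, RtoC, cis; simpl;
  apply injective_projections; simpl; try ring.

Lemma Cx_ring : ring_theory Cx0 Cx1 Cadd Cmul Csub Copp (@eq Cx).
Proof. constructor; cx_eq. Qed.
Add Ring Cx_ring_instance : Cx_ring.

Lemma Cmod_Coquelicot z : Cmod z = Complex.Cmod z.
Proof. unfold Cmod, Complex.Cmod. f_equal. simpl. ring. Qed.

Lemma Cmod_mul z w : Cmod (Cmul z w) = Cmod z * Cmod w.
Proof. rewrite !Cmod_Coquelicot. apply Complex.Cmod_mult. Qed.

Lemma Cmod_add z w : Cmod (Cadd z w) <= Cmod z + Cmod w.
Proof. rewrite !Cmod_Coquelicot. apply Complex.Cmod_triangle. Qed.

Lemma Cmod_nonneg z : 0 <= Cmod z.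
Proof. apply sqrt_pos. Qed.

Lemma Cmod_opp z : Cmod (Copp z) = Cmod z.
Proof. unfold Cmod. f_equal. simpl. ring. Qed.

Lemma Cmod_real r : Cmod (RtoC r) = Rabs r.
Proof.
  unfold Cmod, RtoC. simpl.
  replace (r * r + 0 * 0) with (Rsqr r) by (unfold Rsqr; ring). apply sqrt_Rsqr_abs.
Qed.

Lemma Cmod_0 : Cmod Cx0 = 0.
Proof. change Cx0 with (RtoC 0). rewrite Cmod_real. apply Rabs_R0. Qed.

Lemma Cmod_sq z : Cmod z * Cmod z = fst z * fst z + snd z * snd z.
Proof. unfold Cmod. apply sqrt_sqrt. nra. Qed.

Lemma Cmul_conj z : Cmul z (Cconj z) = RtoC (Cmod z * Cmod z).
Proof. rewrite Cmod_sq. cx_eq. Qed.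

Lemma Cmul_integral z w : Cmul z w = Cx0 -> z = Cx0 \/ w = Cx0.
Proof.
  intros H.
  assert (E : Cmod z * Cmod w = 0) by (rewrite <- Cmod_mul, H; apply Cmod_0).
  assert (D : forall v, Cmod v = 0 -> v = Cx0).
  { intros v Hv. assert (F := Cmod_sq v). rewrite Hv in F. destruct v as [a b]; simpl in F.
    unfold Cx0. f_equal; nra. }
  apply Rmult_integral in E. destruct E; auto.
Qed.

Lemma RtoC_mul a b : RtoC (a * b) = Cmul (RtoC a) (RtoC b).
Proof. cx_eq. Qed.

Lemma RtoC_add a b : RtoC (a + b) = Cadd (RtoC a) (RtoC b).
Proof. cx_eq. Qed.

Lemma cis_add a b : cis (a + b) = Cmul (cis a) (cis b).
Proof. cx_eq. { apply cos_plus. } rewrite sin_plus. ring. Qed.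

Lemma cis_0 : cis 0 = Cx1.
Proof. unfold cis. now rewrite cos_0, sin_0. Qed.

Lemma cis_conj a : Cconj (cis a) = cis (- a).
Proof. unfold cis, Cconj. simpl. now rewrite cos_neg, sin_neg. Qed.

Lemma Cmod_cis a : Cmod (cis a) = 1.
Proof.
  unfold Cmod, cis. simpl. rewrite <- sqrt_1. f_equal.
  assert (H := sin2_cos2 a). unfold Rsqr in H. lra.
Qed.

Lemma cis_period_nat k : cis (2 * PI * INR k) = Cx1.
Proof.
  induction k. { simpl. rewrite Rmult_0_r. apply cis_0. }
  rewrite S_INR, Rmult_plus_distr_l, cis_add, IHk.
  unfold cis. rewrite Rmult_1_r, cos_2PI, sin_2PI. cx_eq.
Qed.

Lemma cis_period_nat_opp k : cis (- (2 * PI * INR k)) = Cx1.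
Proof. rewrite <- cis_conj, cis_period_nat. cx_eq. Qed.

(** Here |e^(ix) - 1|^2 = 2 - 2 cos x = 4 sin(x/2)^2, and |sin y| <= |y|. *)
Lemma Cmod_cis_sub1 x : Cmod (Csub (cis x) Cx1) <= Rabs x.
Proof.
  apply Rsqr_incr_0; [|apply Cmod_nonneg|apply Rabs_pos].
  unfold Rsqr. rewrite Cmod_sq. unfold Csub, Cadd, Copp, cis, Cx1; simpl.
  rewrite <- Rabs_mult, (Rabs_pos_eq (x * x)) by nra.
  assert (H := sin2_cos2 x). unfold Rsqr in H.
  assert (C : cos x = 1 - 2 * (sin (x / 2) * sin (x / 2))).
  { replace x with (2 * (x / 2)) at 1 by field. rewrite cos_2a_sin. ring. }
  assert (S : sin (x/2) * sin (x/2) <= (x/2) * (x/2)).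
  { apply Rsqr_le_abs_1. apply Rabs_le.
    assert (P : forall y, 0 <= y -> - y <= sin y <= y).
    { intros y [Hy|<-]. 2: rewrite sin_0; lra.
      split. 2: apply Rlt_le, sin_lt_x; auto.
      destruct (Rle_lt_dec y PI). { assert (0 <= sin y) by (apply sin_ge_0; lra). lra. }
      assert (B := SIN_bound y). assert (Q := PI2_1). lra. }
    destruct (Rle_lt_dec 0 (x / 2)).
    - rewrite Rabs_pos_eq by auto. auto.
    - rewrite Rabs_left by auto. assert (Q := P (- (x/2)) ltac:(lra)).
      rewrite sin_neg in Q. lra. }
  nra.
Qed.

Lemma cis_ne_1 x : 0 < x < 2 * PI -> cis x <> Cx1.
Proof.
  intros Hx H. injection H as Hc Hs.
  assert (C : cos x = 1 - 2 * (sin (x / 2) * sin (x / 2))).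
  { replace x with (2 * (x / 2)) at 1 by field. rewrite cos_2a_sin. ring. }
  assert (0 < sin (x / 2)) by (apply sin_gt_0; lra). nra.
Qed.

#[export] Instance Cx_monoid : CMonoid Cx.
Proof.
  refine {| madd := Cadd; mzero := Cx0 |}; intros; ring.
Defined.

Lemma csum_mul_l (c : Cx) (f : nat -> Cx) n :
  bsum (fun i => Cmul c (f i)) n = Cmul c (bsum f n).
Proof.
  symmetry. apply (bsum_morph (fun x => Cmul c x)); intros; simpl; ring.
Qed.

Lemma csum_mul_r (c : Cx) (f : nat -> Cx) n :
  bsum (fun i => Cmul (f i) c) n = Cmul (bsum f n) c.
Proof.
  symmetry. apply (bsum_morph (fun x => Cmul x c)); intros; simpl; ring.
Qed.

Lemma csum_prod (f g : nat -> Cx) n m :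
  Cmul (bsum f n) (bsum g m) = bsum (fun i => bsum (fun j => Cmul (f i) (g j)) m) n.
Proof.
  rewrite <- csum_mul_r. apply bsum_ext. intros. now rewrite csum_mul_l.
Qed.

(** * Exponential sums over roots of unity *)

Lemma csum_geometric x n :
  Cmul (Csub (cis x) Cx1) (bsum (fun t => cis (INR t * x)) n) =
  Csub (cis (INR n * x)) Cx1.
Proof.
  induction n.
  - simpl. rewrite Rmult_0_l, cis_0. ring.
  - cbn [bsum]. change madd with Cadd.
    replace (INR (S n) * x) with (x + INR n * x) by (rewrite S_INR; ring).
    rewrite cis_add.
    transitivity (Cadd (Cmul (Csub (cis x) Cx1) (bsum (fun t => cis (INR t * x)) n))
      (Cmul (Csub (cis x) Cx1) (cis (INR n * x)))). { ring. }
    rewrite IHn. ring.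
Qed.

Lemma csum_one n : bsum (fun _ => Cx1) n = RtoC (INR n).
Proof.
  induction n; simpl bsum. { reflexivity. }
  rewrite IHn, S_INR, RtoC_add. reflexivity.
Qed.

(** For i <> l the step x is a multiple of 2 pi / N, so e^(ix) - 1 annihilates the geometric sum;
    this factor is nonzero because 0 < |i - l| < N. *)
Lemma orthogonality N i l :
  (i < N)%nat -> (l < N)%nat ->
  bsum (fun t => cis (INR t * (2 * PI * (INR i - INR l) / INR N))) N =
  if Nat.eq_dec i l then RtoC (INR N) else Cx0.
Proof.
  intros Hi Hl. assert (HN : 0 < INR N) by (apply lt_0_INR; lia).
  destruct (Nat.eq_dec i l) as [->|Hne].
  - rewrite <- csum_one. apply bsum_ext. intros. rewrite <- cis_0. f_equal. field. lra.
  - set (x := 2 * PI * (INR i - INR l) / INR N).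
    assert (G := csum_geometric x N).
    assert (E1 : cis (INR N * x) = Cx1).
    { replace (INR N * x) with (2 * PI * INR i + - (2 * PI * INR l)) by (unfold x; field; lra).
      rewrite cis_add, cis_period_nat, cis_period_nat_opp. ring. }
    rewrite E1 in G.
    assert (E2 : Cmul (Csub (cis x) Cx1) (bsum (fun t => cis (INR t * x)) N) = Cx0)
      by (rewrite G; ring).
    apply Cmul_integral in E2. destruct E2 as [E2|]; auto. exfalso.
    assert (Ex : cis x = Cx1).
    { replace (cis x) with (Cadd (Csub (cis x) Cx1) Cx1) by ring. rewrite E2. ring. }
    assert (HP := PI_RGT_0).
    assert (rng : forall a b, (a < N)%nat -> (b < a)%nat ->
              0 < 2 * PI * (INR a - INR b) / INR N < 2 * PI).
    { intros a b Ha Hb. apply lt_INR in Hb. assert (Ha' := lt_INR _ _ Ha).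
      assert (Hb0 := pos_INR b).
      split.
      - apply Rdiv_lt_0_compat; auto. apply Rmult_lt_0_compat; lra.
      - apply (Rmult_lt_reg_r (INR N)); auto. unfold Rdiv. rewrite Rmult_assoc, Rinv_l by lra.
        nra. }
    destruct (Nat.lt_ge_cases l i) as [h|h].
    + revert Ex. apply cis_ne_1. apply rng; auto.
    + assert (Ex' : cis (- x) = Cx1) by (rewrite <- cis_conj, Ex; cx_eq).
      revert Ex'. apply cis_ne_1.
      replace (- x) with (2 * PI * (INR l - INR i) / INR N) by (unfold x; field; lra).
      apply rng; lia.
Qed.

Lemma Cconj_bsum (f : nat -> Cx) n : Cconj (bsum f n) = bsum (fun i => Cconj (f i)) n.
Proof. apply bsum_morph; [cx_eq|intros; simpl; cx_eq]. Qed.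

Lemma RtoC_bsum (f : nat -> R) n : RtoC (bsum f n) = bsum (fun i => RtoC (f i)) n.
Proof. apply bsum_morph; [reflexivity|intros; apply RtoC_add]. Qed.

Lemma Cconj_mul z w : Cconj (Cmul z w) = Cmul (Cconj z) (Cconj w).
Proof. cx_eq. Qed.

(** After the square is expanded and the sum over l taken first, orthogonality leaves only the
    diagonal; n <= N keeps the frequencies distinct modulo N. *)
Lemma parseval N n (a : nat -> Cx) :
  (n <= N)%nat ->
  bsum (fun l => let z := bsum (fun s => Cmul (a s) (cis (- (INR l * (2 * PI * INR s / INR N))))) n in
                 Cmod z * Cmod z) N =
  INR N * bsum (fun s => Cmod (a s) * Cmod (a s)) n.
Proof.
  intros Hn.
  destruct (Nat.eq_dec N 0) as [->|HN0]. { simpl; ring. }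
  assert (HN : 0 < INR N) by (apply lt_0_INR; lia).
  cut (forall r r', RtoC r = RtoC r' -> r = r').
  2: { intros r r' H. now injection H. }
  intros inj. apply inj. rewrite RtoC_bsum, RtoC_mul, RtoC_bsum.
  transitivity (bsum (fun l => bsum (fun s => bsum (fun r =>
      Cmul (Cmul (a s) (Cconj (a r)))
           (cis (INR l * (2 * PI * (INR r - INR s) / INR N)))) n) n) N).
  { apply bsum_ext. intros l Hl. cbv zeta. rewrite <- Cmul_conj, Cconj_bsum, csum_prod.
    apply bsum_ext. intros s Hs. apply bsum_ext. intros r Hr.
    rewrite Cconj_mul, cis_conj, Ropp_involutive.
    replace (INR l * (2 * PI * (INR r - INR s) / INR N)) with
     (- (INR l * (2 * PI * INR s / INR N)) + INR l * (2 * PI * INR r / INR N)) by (field; lra).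
    rewrite cis_add. ring. }
  rewrite bsum_exchange, <- csum_mul_l. apply bsum_ext. intros s Hs.
  rewrite bsum_exchange.
  rewrite (bsum_single _ n s); auto.
  - rewrite csum_mul_l, orthogonality by lia.
    destruct (Nat.eq_dec s s); [|lia]. rewrite Cmul_conj. ring.
  - intros r Hr Hrs. rewrite csum_mul_l, orthogonality by lia.
    destruct (Nat.eq_dec r s); [lia|]. simpl. ring.
Qed.

Lemma bsum_exchange_pairs {V} {M : CMonoid V} (h : nat -> nat -> nat -> nat -> V) a b c d :
  bsum (fun s => bsum (fun t => bsum (fun i => bsum (fun l => h s t i l) d) c) b) a =
  bsum (fun i => bsum (fun l => bsum (fun s => bsum (fun t => h s t i l) b) a) d) c.
Proof.
  erewrite bsum_ext. 2: { intros. apply bsum_exchange. }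
  rewrite bsum_exchange. apply bsum_ext. intros i _.
  erewrite bsum_ext. 2: { intros. apply bsum_exchange. }
  apply bsum_exchange.
Qed.

Lemma trig_energy N n p ph (a : nat -> Cx) c :
  (0 < N)%nat -> (n <= N)%nat -> (forall s, (s < n)%nat -> Cmod (a s) <= c) ->
  bsum (fun l =>
    let z := bsum (fun s => Cmul (a s) (cis (- (INR (p + l) * (2 * PI * INR s / INR N + ph))))) n
    in Cmod z * Cmod z) N <= INR N * (INR n * (c * c)).
Proof.
  intros HN Hn Ha. assert (HN' : 0 < INR N) by now apply lt_0_INR.
  (* [a'] absorbs the phase that does not depend on l. What remains besides the Fourier kernel is
     e^(-i l ph), which does not depend on s and has modulus 1, so Parseval applies to any window of
     N indices. *)
  set (a' := fun s => Cmul (a s) (cis (- (INR p * (2 * PI * INR s / INR N + ph))))).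
  assert (Ha' : forall s, Cmod (a' s) = Cmod (a s)).
  { intros. unfold a'. rewrite Cmod_mul, Cmod_cis. ring. }
  rewrite (bsum_ext _ (fun l =>
    let z := bsum (fun s => Cmul (a' s) (cis (- (INR l * (2 * PI * INR s / INR N))))) n
    in Cmod z * Cmod z)).
  - rewrite parseval by auto. apply Rmult_le_compat_l. { lra. }
    apply rsum_bound. intros s Hs. rewrite Ha'. assert (H := Ha s Hs).
    assert (H0 := Cmod_nonneg (a s)). nra.
  - intros l Hl. cbv zeta.
    rewrite (bsum_ext _ (fun s => Cmul (cis (- (INR l * ph)))
       (Cmul (a' s) (cis (- (INR l * (2 * PI * INR s / INR N))))))).
    + rewrite csum_mul_l, Cmod_mul, Cmod_cis. ring.
    + intros s Hs. unfold a'. rewrite plus_INR.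
      replace (- ((INR p + INR l) * (2 * PI * INR s / INR N + ph))) with
        (- (INR p * (2 * PI * INR s / INR N + ph)) +
          (- (INR l * ph) + - (INR l * (2 * PI * INR s / INR N)))) by (field; lra).
      rewrite !cis_add. ring.
Qed.

(** AM-GM with a free weight, in the role of the Cauchy-Schwarz inequality; [lam] is chosen later to
    balance P against Q. *)
Lemma rsum_mul_le (x y : nat -> R) n lam P Q :
  0 < lam -> bsum (fun i => x i * x i) n <= P -> bsum (fun i => y i * y i) n <= Q ->
  bsum (fun i => x i * y i) n <= (P / lam + lam * Q) / 2.
Proof.
  intros Hl HP HQ.
  apply Rle_trans with (bsum (fun i => / (2 * lam) * (x i * x i) + lam / 2 * (y i * y i)) n).
  - apply rsum_le. intros i _.
    assert (E : / (2 * lam) * (x i * x i) + lam / 2 * (y i * y i) - x i * y i =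
       (x i - lam * y i) * (x i - lam * y i) * / (2 * lam)) by (field; lra).
    assert (0 < / (2 * lam)) by (apply Rinv_0_lt_compat; lra).
    assert (0 <= (x i - lam * y i) * (x i - lam * y i)) by apply Rle_0_sqr.
    assert (0 <= (x i - lam * y i) * (x i - lam * y i) * / (2 * lam))
      by (apply Rmult_le_pos; lra). lra.
  - rewrite rsum_add, !rsum_scal.
    assert (0 < / (2 * lam)) by (apply Rinv_0_lt_compat; lra).
    apply Rle_trans with (/ (2 * lam) * P + lam / 2 * Q).
    + apply Rplus_le_compat; apply Rmult_le_compat_l; lra.
    + right. field. lra.
Qed.

(** This is 2 pi (t + s - 2 D) / N: t numbers the roots of unity and s < D is the rotation that is
    averaged out. For t < 3 D the offset t + s - 2 D stays within 2 D of 0. *)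
Definition angle (N D s t : nat) : R :=
  2 * PI * INR t / INR N + (2 * PI * INR s / INR N + - (2 * PI * INR (2 * D) / INR N)).

(** Multiplier of [u j] in the rotated sum of (w - 1) H_w over the near arc, up to the factor 1/N^2;
    it occurs once for each pair (i, l) with 1 + i + l = j. *)
Definition near_coef (N D j : nat) : Cx :=
  bsum (fun s => bsum (fun t => Cmul (Csub (cis (angle N D s t)) Cx1)
      (cis (- (INR j * angle N D s t)))) (3 * D)) D.

(* The factor [cis - 1] is split by [e^(i(a+b)) - 1 = (e^(ia) - 1) e^(ib) + (e^(ib) - 1)], so that
   the coefficient becomes a sum of two products of exponential sums, each controlled by AM-GM
   and Parseval. *)
Lemma near_coef_sum N D p :
  (0 < D)%nat -> (3 * D <= N)%nat ->
  bsum (fun l => Cmod (near_coef N D (p + l))) N <=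
  6 * INR N * INR D * (2 * PI * INR D / INR N).
Proof.
  intros HD HN. assert (HN' : 0 < INR N) by (apply lt_0_INR; lia).
  assert (HD' : 0 < INR D) by (apply lt_0_INR; lia).
  assert (HP := PI_RGT_0).
  set (del := 2 * PI * INR D / INR N).
  assert (Hdel : 0 < del) by (apply Rdiv_lt_0_compat; auto; nra).
  set (ph := - (2 * PI * INR (2 * D) / INR N)).
  set (al := fun s => 2 * PI * INR s / INR N + 0).
  set (be := fun t => 2 * PI * INR t / INR N + ph).
  set (expsum := fun (a : nat -> Cx) (th : nat -> R) n j =>
    bsum (fun s => Cmul (a s) (cis (- (INR j * th s)))) n).
  set (A1 := fun s => Csub (cis (al s)) Cx1). set (A0 := fun _ : nat => Cx1).
  set (B1 := fun t => cis (be t)). set (B2 := fun t => Csub (cis (be t)) Cx1).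
  assert (split : forall j, near_coef N D j =
    Cadd (Cmul (expsum A1 al D j) (expsum B1 be (3 * D)%nat j))
         (Cmul (expsum A0 al D j) (expsum B2 be (3 * D)%nat j))).
  { intros j. unfold expsum at 1 2 3 4. rewrite !csum_prod.
    change Cadd with (@madd Cx _). rewrite <- bsum_add. apply bsum_ext. intros s Hs.
    rewrite <- bsum_add. apply bsum_ext. intros t Ht. change (@madd Cx _) with Cadd.
    assert (E : angle N D s t = al s + be t) by (unfold angle, al, be, ph; ring).
    rewrite E. unfold A1, A0, B1, B2.
    replace (- (INR j * (al s + be t))) with (- (INR j * al s) + - (INR j * be t)) by ring.
    rewrite !cis_add. ring. }
  assert (small : forall x c, Rabs x <= c -> Cmod (Csub (cis x) Cx1) <= c).
  { intros. eapply Rle_trans. { apply Cmod_cis_sub1. } auto. }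
  assert (a1 : forall s, (s < D)%nat -> Cmod (A1 s) <= del).
  { intros s Hs. apply small. unfold al. rewrite Rplus_0_r.
    apply lt_INR in Hs. assert (H0 := pos_INR s).
    rewrite Rabs_pos_eq.
    - unfold del, Rdiv. apply Rmult_le_compat_r. { apply Rlt_le, Rinv_0_lt_compat; auto. } nra.
    - apply Rmult_le_pos; [nra|]. apply Rlt_le, Rinv_0_lt_compat; auto. }
  assert (b2 : forall t, (t < 3 * D)%nat -> Cmod (B2 t) <= 2 * del).
  { intros t Ht. apply small. unfold be, ph.
    apply lt_INR in Ht. assert (H0 := pos_INR t). rewrite mult_INR in *. simpl (INR 2). simpl (INR 3) in Ht.
    replace (2 * PI * INR t / INR N + - (2 * PI * ((1 + 1) * INR D) / INR N)) with
      (2 * PI / INR N * (INR t - 2 * INR D)) by (field; lra).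
    replace (2 * del) with (2 * PI / INR N * (2 * INR D)) by (unfold del; field; lra).
    assert (0 < 2 * PI / INR N) by (apply Rdiv_lt_0_compat; lra).
    rewrite Rabs_mult, (Rabs_pos_eq (2 * PI / INR N)) by lra.
    apply Rmult_le_compat_l. { lra. } apply Rabs_le. lra. }
  assert (m1 : Cmod Cx1 = 1) by (rewrite <- cis_0; apply Cmod_cis).
  assert (e1 := trig_energy N D p 0 A1 del ltac:(lia) ltac:(lia) a1).
  assert (e0 := trig_energy N D p 0 A0 1 ltac:(lia) ltac:(lia)
     ltac:(intros; unfold A0; lra)).
  assert (f1 := trig_energy N (3 * D) p ph B1 1 ltac:(lia) ltac:(lia)
     ltac:(intros; unfold B1; rewrite Cmod_cis; lra)).
  assert (f2 := trig_energy N (3 * D) p ph B2 (2 * del) ltac:(lia) ltac:(lia) b2).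
  (* The weights [del] and [/ (2 * del)] make the two products contribute 2 N D [del] and 4 N D
     [del]. Estimating each coefficient termwise would give a bound larger by a factor D. *)
  assert (q1 := rsum_mul_le (fun l => Cmod (expsum A1 al D (p + l)%nat))
     (fun l => Cmod (expsum B1 be (3 * D)%nat (p + l)%nat)) N del _ _ Hdel e1 f1).
  assert (q2 := rsum_mul_le (fun l => Cmod (expsum A0 al D (p + l)%nat))
     (fun l => Cmod (expsum B2 be (3 * D)%nat (p + l)%nat)) N (/ (2 * del)) _ _
     ltac:(apply Rinv_0_lt_compat; lra) e0 f2).
  apply Rle_trans with
    (bsum (fun l => Cmod (expsum A1 al D (p + l)%nat) * Cmod (expsum B1 be (3 * D)%nat (p + l)%nat)
       + Cmod (expsum A0 al D (p + l)%nat) * Cmod (expsum B2 be (3 * D)%nat (p + l)%nat)) N).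
  - apply rsum_le. intros l Hl. rewrite split. eapply Rle_trans. { apply Cmod_add. }
    rewrite !Cmod_mul. lra.
  - rewrite rsum_add. eapply Rle_trans. { apply Rplus_le_compat; [apply q1|apply q2]. }
    rewrite mult_INR. simpl (INR 3). right. field. lra.
Qed.

(** * Cesàro numbers *)

Lemma kcoef_pos g n : 0 < g -> 0 < kcoef g n.
Proof.
  intros Hg. induction n; cbn [kcoef]. { lra. }
  apply Rmult_lt_0_compat; auto. assert (H := pos_INR n). assert (0 < INR (S n)) by apply lt_0_INR, Nat.lt_0_succ.
  apply Rdiv_lt_0_compat; lra.
Qed.

Lemma kcoef_ratio g n : kcoef (g + 1) n * g = kcoef g n * (g + INR n).
Proof.
  induction n. { simpl; ring. }
  cbn [kcoef]. rewrite S_INR. assert (H := pos_INR n).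
  transitivity (kcoef (g + 1) n * g * ((g + 1 + INR n) / (INR n + 1))). { field. lra. }
  rewrite IHn. field. lra.
Qed.

(** The numbers [kcoef g] are the Taylor coefficients of (1 - z)^(-g); multiplying by 1 / (1 - z)
    forms partial sums. *)
Lemma kcoef_pascal g n : kcoef (g + 1) (S n) = kcoef (g + 1) n + kcoef g (S n).
Proof.
  cbn [kcoef]. rewrite S_INR. assert (H := pos_INR n).
  transitivity (kcoef (g + 1) n + kcoef (g + 1) n * g / (INR n + 1)). { field. lra. }
  rewrite kcoef_ratio. field. lra.
Qed.

Lemma kcoef_succ a n : kcoef (a + 1) (S n) = kcoef (a + 1) n * (1 + a / INR (S n)).
Proof. cbn [kcoef]. rewrite S_INR. assert (H := pos_INR n). field. lra. Qed.

Lemma kcoef_mono a n m : 0 <= a -> (n <= m)%nat -> kcoef (a + 1) n <= kcoef (a + 1) m.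
Proof.
  intros Ha H. induction H. { lra. }
  eapply Rle_trans. { apply IHle. } rewrite kcoef_succ.
  assert (0 < kcoef (a + 1) m) by (apply kcoef_pos; lra).
  assert (0 < INR (S m)) by apply lt_0_INR, Nat.lt_0_succ.
  assert (0 <= a / INR (S m)) by (apply Rmult_le_pos; auto; apply Rlt_le, Rinv_0_lt_compat; auto).
  nra.
Qed.

(** From m to m + 1 the left side grows by 1 + a/(m+1) <= exp(a/(m+1)), and 1/(m+1) <= ln((m+1)/m),
    so the growth is at most ((m+1)/m)^a. The constant is the value at n = 1. *)
Lemma kcoef_le_Rpower a n :
  0 <= a -> (1 <= n)%nat -> kcoef (a + 1) n <= (1 + a) * Rpower (INR n) a.
Proof.
  intros Ha H. induction H.
  - simpl. unfold Rpower. rewrite ln_1, Rmult_0_r, exp_0. right. field.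
  - rewrite kcoef_succ.
    assert (Hm : 1 <= INR m) by (apply (le_INR 1); auto).
    assert (Hs : INR (S m) = INR m + 1) by apply S_INR.
    assert (Hd : 0 <= a / INR (S m)) by (apply Rmult_le_pos; auto; apply Rlt_le, Rinv_0_lt_compat; lra).
    apply Rle_trans with ((1 + a) * Rpower (INR m) a * (1 + a / INR (S m))).
    { apply Rmult_le_compat_r; lra. }
    rewrite Rmult_assoc. apply Rmult_le_compat_l. { lra. }
    unfold Rpower.
    apply Rle_trans with (exp (a * ln (INR m)) * exp (a / INR (S m))).
    { apply Rmult_le_compat_l. { apply Rlt_le, exp_pos. } apply exp_ineq1_le. }
    rewrite <- exp_plus.
    assert (E : a * ln (INR m) + a / INR (S m) <= a * ln (INR (S m))).
    { assert (L : ln (INR m / INR (S m)) <= INR m / INR (S m) - 1).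
      { assert (0 < INR m / INR (S m)) by (apply Rdiv_lt_0_compat; lra).
        assert (Q := exp_ineq1_le (ln (INR m / INR (S m)))). rewrite exp_ln in Q; lra. }
      unfold Rdiv in L at 1. rewrite ln_mult, ln_Rinv in L by (try apply Rinv_0_lt_compat; lra).
      replace (INR m / INR (S m) - 1) with (- (1 / INR (S m))) in L by (rewrite Hs; field; lra).
      replace (a / INR (S m)) with (a * (1 / INR (S m))) by (field; lra). nra. }
    destruct E as [E|E]. { apply Rlt_le, exp_increasing, E. } rewrite E. lra.
Qed.

(** The quotient is a product of j factors, each at most 1 + a/n. *)
Lemma kcoef_shift a j :
  0 <= a -> exists d, 0 <= d /\
  forall n, (1 <= n)%nat -> kcoef (a + 1) (n + j) <= (1 + d / INR n) * kcoef (a + 1) n.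
Proof.
  intros Ha. induction j as [|j [d [Hd IH]]].
  - exists 0. split. { lra. } intros n Hn. rewrite Nat.add_0_r. unfold Rdiv. lra.
  (* This constant comes from (1 + d/n)(1 + a/n), using 1/n^2 <= 1/n. *)
  - exists (d + a + d * a). split. { nra. } intros n Hn. rewrite Nat.add_succ_r, kcoef_succ.
    assert (Hn' : 1 <= INR n) by (apply (le_INR 1); auto).
    assert (Hm : INR n <= INR (S (n + j))) by (apply le_INR; lia).
    assert (Hi : 0 < / INR n <= 1).
    { split. { apply Rinv_0_lt_compat; lra. } rewrite <- Rinv_1. apply Rinv_le_contravar; lra. }
    assert (Hi' : 0 < / INR (S (n + j)) <= / INR n).
    { split. { apply Rinv_0_lt_compat; lra. } apply Rinv_le_contravar; lra. }
    assert (k0 : 0 < kcoef (a + 1) n) by (apply kcoef_pos; lra).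
    unfold Rdiv in *. set (i := / INR n) in *. set (i' := / INR (S (n + j))) in *.
    apply Rle_trans with ((1 + d * i) * kcoef (a + 1) n * (1 + a * i)).
    + specialize (IH n Hn). fold i in IH. apply Rmult_le_compat; auto.
      * apply Rlt_le, kcoef_pos. lra.
      * nra.
      * nra.
    + replace ((1 + d * i) * kcoef (a + 1) n * (1 + a * i)) with
       ((1 + d * i) * (1 + a * i) * kcoef (a + 1) n) by ring.
      apply Rmult_le_compat_r. { lra. }
      assert (d * a * (i * i) <= d * a * i) by (apply Rmult_le_compat_l; nra). nra.
Qed.

(** Coefficient comparison in (1 - z)^(-a) (1 - z)^(-b) = (1 - z)^(-(a+b)), valid for all real
    orders. The induction multiplies by n + 1 and uses the recurrence (m+1) k^g(m+1) = (g+m)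
    k^g(m). *)
Lemma kcoef_vandermonde a b n :
  bsum (fun j => kcoef a j * kcoef b (n - j)) (S n) = kcoef (a + b) n.
Proof.
  induction n. { simpl. ring. }
  assert (rec : forall g m, INR (S m) * kcoef g (S m) = (g + INR m) * kcoef g m).
  { intros. cbn [kcoef]. assert (H := pos_INR m). rewrite S_INR. field. lra. }
  assert (HS : 0 < INR (S n)) by apply lt_0_INR, Nat.lt_0_succ.
  apply (Rmult_eq_reg_l (INR (S n))). 2: lra.
  rewrite rec, <- IHn, <- !rsum_scal.
  (* The weight n + 1 is split as j + (n + 1 - j), so that the recurrence applies to one factor in
     each half. *)
  rewrite (bsum_ext _ (fun j => INR j * kcoef a j * kcoef b (S n - j)
     + kcoef a j * (INR (S n - j) * kcoef b (S n - j)))).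
  2: { intros j Hj. rewrite minus_INR by lia. ring. }
  rewrite rsum_add.
  rewrite (bsum_first (fun j => INR j * kcoef a j * kcoef b (S n - j))).
  cbn [bsum]. change (@madd R _) with Rplus. rewrite Nat.sub_diag.
  rewrite (bsum_ext (fun i => INR (S i) * _ * _) (fun j => (a + INR j) * kcoef a j * kcoef b (n - j)) n)
    by (intros; now rewrite rec, Nat.sub_succ).
  rewrite (bsum_ext (fun j => _ * (INR (S n - j) * _)) (fun j => kcoef a j * ((b + INR (n - j)) * kcoef b (n - j))) n)
    by (intros j Hj; rewrite Nat.sub_succ_l by lia; now rewrite rec).
  simpl (INR 0).
  rewrite (bsum_ext (fun i => (a + b + INR n) * _) (fun j => (a + INR j) * kcoef a j * kcoef b (n - j)
     + kcoef a j * ((b + INR (n - j)) * kcoef b (n - j)))).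
  2: { intros j Hj. rewrite minus_INR by lia. ring. }
  rewrite rsum_add. rewrite rec, !Nat.sub_diag.
  rewrite (Nat.sub_succ_l n n), Nat.sub_diag by lia. rewrite rec. simpl. ring.
Qed.

Lemma kcoef_0_succ n : kcoef 0 (S n) = 0.
Proof.
  induction n. { simpl. field. } cbn [kcoef] in *. rewrite IHn. ring.
Qed.

(* For [m >= b], [|k^(-b)(m+1)|] telescopes as [|k^(1-b)(m)| - |k^(1-b)(m+1)|]. *)
Lemma kcoef_neg_summable b :
  0 <= b -> exists C, 0 <= C /\ forall n, bsum (fun j => Rabs (kcoef (- b) j)) n <= C.
Proof.
  intros Hb. destruct (INR_unbounded b) as [J HJ].
  set (f := fun j => Rabs (kcoef (- b) j)).
  set (h := fun m => Rabs (kcoef (- b + 1) m)).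
  assert (fpos : forall j, 0 <= f j) by (intros; apply Rabs_pos).
  assert (spos : forall g n, (forall j, 0 <= g j) -> 0 <= bsum g n).
  { intros g n Hg. induction n; simpl. { lra. } specialize (Hg n). lra. }
  assert (tele : forall m, (J <= m)%nat -> f (S m) = h m - h (S m)).
  { intros m Hm. apply le_INR in Hm. unfold f, h.
    assert (E : kcoef (- b) (S m) = kcoef (- b + 1) m * - (b / (INR m + 1))).
    { assert (P := kcoef_pascal (- b) m). rewrite kcoef_succ, S_INR in P.
      apply (Rplus_eq_reg_l (kcoef (- b + 1) m)). rewrite <- P. field. lra. }
    rewrite E, kcoef_succ, S_INR, !Rabs_mult, Rabs_Ropp.
    assert (H0 : 0 <= b / (INR m + 1)) by (apply Rmult_le_pos; auto; apply Rlt_le, Rinv_0_lt_compat; lra).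
    assert (H1 : b / (INR m + 1) <= 1).
    { apply (Rmult_le_reg_r (INR m + 1)). { lra. } unfold Rdiv. rewrite Rmult_assoc, Rinv_l by lra. lra. }
    replace (1 + - b / (INR m + 1)) with (1 - b / (INR m + 1)) by (field; lra).
    rewrite (Rabs_pos_eq (b / _)), (Rabs_pos_eq (1 - _)) by lra. ring. }
  assert (tail : forall n, bsum (fun i => f (S J + i)%nat) n = h J - h (J + n)%nat).
  { induction n. { simpl. rewrite Nat.add_0_r. ring. }
    cbn [bsum]. rewrite IHn. change (S J + n)%nat with (S (J + n)).
    rewrite tele by lia. rewrite Nat.add_succ_r. simpl. ring. }
  exists (bsum f (S J) + h J). split.
  - assert (A := spos f (S J) fpos). assert (0 <= h J) by apply Rabs_pos. lra.
  - intros n. apply Rle_trans with (bsum f (S J + n)).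
    + rewrite Nat.add_comm, bsum_cat. change (@madd R _) with Rplus.
      assert (A := spos (fun i => f (n + i)%nat) (S J) ltac:(intros; apply fpos)). lra.
    + rewrite bsum_cat. rewrite tail. change (@madd R _) with Rplus.
      assert (0 <= h (J + n)%nat) by apply Rabs_pos. lra.
Qed.

Lemma eventually_forall_le (P : nat -> nat -> Prop) :
  (forall j, exists n0, forall n, (n0 <= n)%nat -> P j n) ->
  forall J, exists n0, forall n, (n0 <= n)%nat -> forall j, (j <= J)%nat -> P j n.
Proof.
  intros H J. induction J as [|J [n1 IH]].
  - destruct (H O) as [n0 H0]. exists n0. intros n Hn j Hj.
    replace j with O by lia. auto.
  - destruct (H (S J)) as [n0 H0]. exists (Nat.max n0 n1). intros n Hn j Hj.
    destruct (Nat.eq_dec j (S J)) as [->|]; [apply H0 | apply IH]; lia.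
Qed.

Lemma eventually_div_le c eps :
  0 < eps -> exists n0, (1 <= n0)%nat /\ forall n, (n0 <= n)%nat -> c / INR n <= eps.
Proof.
  intros He. destruct (INR_unbounded (Rabs c / eps)) as [n0 Hn0].
  exists (S n0). split. { lia. } intros n Hn.
  assert (Hn' : INR n0 <= INR n) by (apply le_INR; lia).
  assert (0 < INR n) by (apply lt_0_INR; lia).
  assert (h := Rle_abs c). assert (Rabs c = Rabs c / eps * eps) by (field; lra).
  apply (Rmult_le_reg_r (INR n)); auto. unfold Rdiv at 1. rewrite Rmult_assoc, Rinv_l by lra.
  nra.
Qed.


(** * Vector identities *)

Section Banach.
Variable X : CBanach.

Declare Scope vec_scope.
Delimit Scope vec_scope with V.
Local Notation "x + y" := (vadd X x y) : vec_scope.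
Local Notation "- x" := (vopp X x) : vec_scope.
Local Notation "x - y" := (vadd X x (vopp X y)) : vec_scope.
Local Notation "c *: x" := (vscal X c x) (at level 40, x at next level, format "c  *:  x") : vec_scope.
Local Notation "'|' x '|'" := (vnorm X x) (at level 35, x at level 50, format "| x |") : R_scope.
Implicit Types x y z : X.
Implicit Types u v : nat -> X.

#[export] Instance vec_monoid : CMonoid X.
Proof.
  refine {| madd := vadd X; mzero := vzero X |}.
  - apply vadd_assoc.
  - apply vadd_comm.
  - apply vadd_0.
Defined.

Lemma vadd_cancel_self x : (x + x)%V = x -> x = vzero X.
Proof.
  intros H. rewrite <- (vadd_opp X x). rewrite <- H at 2.
  now rewrite <- vadd_assoc, vadd_opp, (vadd_comm X x), vadd_0.
Qed.

Lemma vscal_0 x : (Cx0 *: x)%V = vzero X.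
Proof.
  apply vadd_cancel_self. rewrite <- vscal_addc. f_equal. ring.
Qed.

Lemma vscal_vzero c : (c *: vzero X)%V = vzero X.
Proof.
  apply vadd_cancel_self. rewrite <- vscal_addv. now rewrite vadd_0.
Qed.

Lemma vopp_scal x : (- x)%V = (Copp Cx1 *: x)%V.
Proof.
  transitivity (- x + (x + Copp Cx1 *: x))%V.
  - rewrite <- (vscal_1 X x) at 3. rewrite <- vscal_addc.
    replace (Cadd Cx1 (Copp Cx1)) with Cx0 by ring.
    now rewrite vscal_0, vadd_comm, vadd_0.
  - rewrite vadd_assoc, (vadd_comm X (- x)%V), vadd_opp. apply vadd_0.
Qed.

(* Module identities over [Cx] are decided by [ring] in the square-zero extension
   [Cx (+) X], where [(c, x) (d, y) = (c d, c y + d x)]. *)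
Definition sqz : Type := (Cx * X)%type.
Definition sqz_add (p q : sqz) : sqz := (Cadd (fst p) (fst q), snd p + snd q)%V.
Definition sqz_mul (p q : sqz) : sqz :=
  (Cmul (fst p) (fst q), fst p *: snd q + fst q *: snd p)%V.
Definition sqz_opp (p : sqz) : sqz := (Copp (fst p), - snd p)%V.
Definition sqz_sub (p q : sqz) : sqz := sqz_add p (sqz_opp q).
Definition sqz_cst (c : Cx) : sqz := (c, vzero X).
Definition sqz_vec (x : X) : sqz := (Cx0, x).

Lemma sqz_ring :
  ring_theory (sqz_cst Cx0) (sqz_cst Cx1) sqz_add sqz_mul sqz_sub sqz_opp (@eq sqz).
Proof.
  constructor; intros;
  repeat match goal with p : sqz |- _ => destruct p end;
  unfold sqz_add, sqz_mul, sqz_sub, sqz_opp, sqz_cst; simpl;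
  apply injective_projections; simpl; try ring.
  - apply vadd_0.
  - apply vadd_comm.
  - apply vadd_assoc.
  - now rewrite vscal_1, vscal_vzero, vadd_comm, vadd_0.
  - apply vadd_comm.
  - rewrite !vscal_addv, <- !vscal_mul, vadd_assoc. f_equal.
    + f_equal. f_equal. ring.
    + f_equal. ring.
  - rewrite !vscal_addv, !vscal_addc.
    rewrite <- !vadd_assoc. f_equal. rewrite !vadd_assoc. f_equal. apply vadd_comm.
  - reflexivity.
  - apply vadd_opp.
Qed.
Add Ring sqz_ring_instance : sqz_ring.

Lemma sqz_vec_inj x y : sqz_vec x = sqz_vec y -> x = y.
Proof. intros H. now injection H. Qed.
Lemma sqz_vec_add x y : sqz_vec (x + y)%V = sqz_add (sqz_vec x) (sqz_vec y).
Proof. unfold sqz_vec, sqz_add; simpl. f_equal. ring. Qed.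
Lemma sqz_vec_opp x : sqz_vec (- x)%V = sqz_opp (sqz_vec x).
Proof. unfold sqz_vec, sqz_opp; simpl. f_equal. ring. Qed.
Lemma sqz_vec_scal c x : sqz_vec (c *: x)%V = sqz_mul (sqz_cst c) (sqz_vec x).
Proof.
  unfold sqz_vec, sqz_mul; simpl. rewrite vscal_vzero, vadd_comm, vadd_0. f_equal. ring.
Qed.
Lemma sqz_vec_zero : sqz_vec (vzero X) = sqz_cst Cx0.
Proof. reflexivity. Qed.
Lemma sqz_cst_add c d : sqz_cst (Cadd c d) = sqz_add (sqz_cst c) (sqz_cst d).
Proof. unfold sqz_cst, sqz_add; simpl. now rewrite vadd_0. Qed.
Lemma sqz_cst_mul c d : sqz_cst (Cmul c d) = sqz_mul (sqz_cst c) (sqz_cst d).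
Proof. unfold sqz_cst, sqz_mul; simpl. now rewrite !vscal_vzero, vadd_0. Qed.
Lemma sqz_cst_opp c : sqz_cst (Copp c) = sqz_opp (sqz_cst c).
Proof.
  unfold sqz_cst, sqz_opp; simpl. f_equal. now rewrite vopp_scal, vscal_vzero.
Qed.
Lemma sqz_cst_sub c d : sqz_cst (Csub c d) = sqz_sub (sqz_cst c) (sqz_cst d).
Proof. unfold Csub, sqz_sub. now rewrite sqz_cst_add, sqz_cst_opp. Qed.

Ltac vec := apply sqz_vec_inj;
  repeat rewrite ?sqz_vec_add, ?sqz_vec_opp, ?sqz_vec_scal, ?sqz_vec_zero,
    ?sqz_cst_add, ?sqz_cst_mul, ?sqz_cst_opp, ?sqz_cst_sub; ring.

Lemma vnorm_opp x : |(- x)%V| = |x|.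
Proof.
  rewrite vopp_scal, vnorm_scal, Cmod_opp. change Cx1 with (RtoC 1).
  rewrite Cmod_real, Rabs_R1. ring.
Qed.

Lemma vnorm_vzero : |vzero X| = 0.
Proof. rewrite <- (vscal_0 (vzero X)), vnorm_scal, Cmod_0. ring. Qed.

Lemma vnorm_nonneg x : 0 <= |x|.
Proof.
  assert (H := vnorm_triangle X x (- x)%V).
  rewrite vadd_opp, vnorm_vzero, vnorm_opp in H. lra.
Qed.

Lemma vnorm_sub x y : |(x - y)%V| <= |x| + |y|.
Proof. rewrite <- (vnorm_opp y). apply vnorm_triangle. Qed.

Lemma vnorm_cis t x : |(cis t *: x)%V| = |x|.
Proof. rewrite vnorm_scal, Cmod_cis. ring. Qed.

Lemma vnorm_real r x : 0 <= r -> |(RtoC r *: x)%V| = r * |x|.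
Proof. intros. rewrite vnorm_scal, Cmod_real, Rabs_pos_eq; auto. Qed.

Lemma bsum_vscal c u n : bsum (fun i => c *: u i)%V n = (c *: bsum u n)%V.
Proof.
  symmetry. apply (bsum_morph (fun x => (c *: x)%V)); intros; simpl.
  - apply vscal_vzero.
  - apply vscal_addv.
Qed.

Lemma bsum_vscal_r (c : nat -> Cx) x n : bsum (fun i => c i *: x)%V n = (bsum c n *: x)%V.
Proof.
  symmetry. apply (bsum_morph (fun d => (d *: x)%V)); intros; simpl.
  - apply vscal_0.
  - apply vscal_addc.
Qed.

Lemma bsum_vadd u v n : bsum (fun i => u i + v i)%V n = (bsum u n + bsum v n)%V.
Proof. exact (bsum_add u v n). Qed.

Lemma bsum_vopp u n : bsum (fun i => - u i)%V n = (- bsum u n)%V.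
Proof.
  rewrite vopp_scal, <- bsum_vscal. apply bsum_ext. intros; apply vopp_scal.
Qed.

Lemma bsum_vsub u v n : bsum (fun i => u i - v i)%V n = (bsum u n - bsum v n)%V.
Proof. now rewrite bsum_vadd, bsum_vopp. Qed.

Lemma vnorm_bsum u n : |bsum u n| <= bsum (fun i => |u i|) n.
Proof.
  apply (bsum_subadditive (vnorm X)).
  - simpl. rewrite vnorm_vzero. lra.
  - apply vnorm_triangle.
Qed.

Lemma vnorm_bsum_bound u n c :
  (forall i, (i < n)%nat -> |u i| <= c) -> |bsum u n| <= INR n * c.
Proof. intros H. eapply Rle_trans. { apply vnorm_bsum. } now apply rsum_bound. Qed.

(** * Averages along an orbit *)

(** Along an orbit of T this applies A_w = (1/N) sum_(i < N) (T/w)^i with w = e^(it). It acts on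
    arbitrary sequences, so that T enters only where an orbit is required. *)
Definition avg (N : nat) (t : R) v (m : nat) : X :=
  (RtoC (/ INR N) *: bsum (fun i => cis (- (INR i * t)) *: v (m + i)%nat) N)%V.

(** This is H_w = (T/w) A_w^2, with triangular weights on (T/w)^k for 1 <= k <= 2N - 1. The extra
    factor T/w puts the peak at k = N. *)
Definition fejer (N : nat) (t : R) u (m : nat) : X :=
  (cis (- t) *: avg N t (avg N t u) (S m))%V.

Lemma avg_norm N t v m B :
  (0 < N)%nat -> (forall i, (i < N)%nat -> |v (m + i)%nat| <= B) -> |avg N t v m| <= B.
Proof.
  intros HN H. assert (0 < INR N) by now apply lt_0_INR.
  unfold avg. rewrite vnorm_real by (apply Rlt_le, Rinv_0_lt_compat; auto).
  apply (Rmult_le_reg_l (INR N)); auto. rewrite <- Rmult_assoc, Rinv_r, Rmult_1_l by lra.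
  apply vnorm_bsum_bound. intros. rewrite vnorm_cis. auto.
Qed.

(** Telescoping: (T - w) A_w = (w/N) ((T/w)^N - 1), where w^N = 1. *)
Lemma avg_shift N t v m :
  cis (INR N * t) = Cx1 ->
  (avg N t v (S m) - cis t *: avg N t v m)%V =
  (Cmul (RtoC (/ INR N)) (cis t) *: (v (m + N)%nat - v m))%V.
Proof.
  intros HN.
  set (P := fun i => (cis (- (INR i * t)) *: v (S m + i)%nat)%V).
  set (Q := fun i => (cis (- (INR i * t)) *: v (m + i)%nat)%V).
  assert (tele : forall n,
    (bsum P n - cis t *: bsum Q n)%V =
    (cis t *: (cis (- (INR n * t)) *: v (m + n)%nat - v m))%V).
  { induction n.
    - cbn [bsum]. change (@mzero X _) with (vzero X).
      rewrite Rmult_0_l, Ropp_0, cis_0, Nat.add_0_r. vec.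
    - cbn [bsum]. change (@madd X _) with (vadd X).
      unfold P at 2, Q at 2.
      set (c := cis (- (INR n * t))) in *.
      assert (Hc : c = Cmul (cis t) (cis (- (INR (S n) * t)))).
      { unfold c. rewrite <- cis_add, S_INR. f_equal. ring. }
      set (c' := cis (- (INR (S n) * t))) in *.
      replace (S m + n)%nat with (m + S n)%nat by lia.
      transitivity (((bsum P n - cis t *: bsum Q n) + c *: v (m + S n)%nat) - Cmul (cis t) c *: v (m + n)%nat)%V.
      { vec. }
      rewrite IHn.
      transitivity (c *: v (m + S n)%nat - cis t *: v m)%V. { vec. }
      rewrite Hc. vec. }
  assert (E : cis (- (INR N * t)) = Cx1) by (rewrite <- cis_conj, HN; cx_eq).
  specialize (tele N). rewrite E in tele. unfold avg. fold P Q.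
  transitivity (RtoC (/ INR N) *: (bsum P N - cis t *: bsum Q N))%V. { vec. }
  rewrite tele. vec.
Qed.

Lemma fejer_expand N t u :
  fejer N t u 0 =
  (RtoC (/ INR N * / INR N) *: bsum (fun i => bsum (fun l =>
     cis (- (INR (S i + l) * t)) *: u (S i + l)%nat) N) N)%V.
Proof.
  unfold fejer, avg at 1. unfold avg.
  rewrite RtoC_mul, vscal_mul. rewrite <- !bsum_vscal. apply bsum_ext. intros i Hi.
  rewrite <- !bsum_vscal. apply bsum_ext. intros l Hl.
  replace (- (INR (S i + l) * t)) with (- t + (- (INR i * t) + - (INR l * t))).
  2: { rewrite plus_INR, S_INR. ring. }
  rewrite !cis_add. change (1 + i + l)%nat with (S i + l)%nat. vec.
Qed.

(** Summing w^(-k) over the rotated roots kills every k in 1..2N-1 except k = N. Each i meets k = 1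
    + i + l = N at the single l = N - 1 - i, so the total weight is N N / N^2 = 1. *)
Lemma fejer_resolution N (t0 : R) u :
  (0 < N)%nat -> cis (INR N * t0) = Cx1 ->
  bsum (fun t => fejer N (2 * PI * INR t / INR N + t0) u 0) N = u N.
Proof.
  intros HN H0. assert (HN' : 0 < INR N) by now apply lt_0_INR.
  erewrite bsum_ext. 2: { intros. apply fejer_expand. }
  rewrite bsum_vscal, bsum_exchange.
  erewrite (bsum_ext _ (fun _ => RtoC (INR N) *: u N)%V).
  - rewrite bsum_vscal. rewrite (bsum_ext _ (fun _ => Cx1 *: u N)%V) by (intros; now rewrite vscal_1).
    rewrite bsum_vscal_r, csum_one, <- !vscal_mul, <- !RtoC_mul.
    replace (/ INR N * / INR N * INR N * INR N) with 1 by (field; lra). apply vscal_1.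
  - intros i Hi. rewrite bsum_exchange.
    assert (key : forall l, (l < N)%nat ->
      bsum (fun t => cis (- (INR (S i + l) * (2 * PI * INR t / INR N + t0))) *: u (S i + l)%nat)%V N =
      (Cmul (if Nat.eq_dec (N - 1 - i) l then RtoC (INR N) else Cx0) (cis (- (INR (S i + l) * t0)))
       *: u (S i + l)%nat)%V).
    { intros l Hl. rewrite bsum_vscal_r. f_equal.
      rewrite <- orthogonality by lia. rewrite <- csum_mul_r. apply bsum_ext. intros t Ht.
      transitivity (Cmul (Cmul (cis (INR t * (2 * PI * (INR (N - 1 - i) - INR l) / INR N)))
        (cis (- (INR (S i + l) * t0)))) (cis (- (2 * PI * INR t)))).
      - rewrite <- !cis_add. f_equal. rewrite plus_INR, S_INR.
        replace (N - 1 - i)%nat with (N - S i)%nat by lia. rewrite minus_INR, S_INR by lia.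
        field. lra.
      - rewrite cis_period_nat_opp. ring. }
    rewrite (bsum_single _ N (N - 1 - i)); try lia.
    + rewrite key by lia. destruct (Nat.eq_dec (N - 1 - i) (N - 1 - i)); [|lia].
      replace (S i + (N - 1 - i))%nat with N by lia.
      rewrite <- cis_conj, H0. f_equal. cx_eq.
    + intros l Hl Hne. rewrite key by lia. destruct (Nat.eq_dec (N - 1 - i) l); [lia|].
      replace (Cmul Cx0 (cis (- (INR (S i + l) * t0)))) with Cx0 by ring. apply vscal_0.
Qed.

(** The factor T - w telescopes one of the two averages, which gains 1/N; the other average does not
    increase the bound. *)
Lemma fejer_shift_norm N t u B :
  (0 < N)%nat -> cis (INR N * t) = Cx1 ->
  (forall j, (j <= 2 * N)%nat -> |u j| <= B) ->
  |(fejer N t u 1 - cis t *: fejer N t u 0)%V| <= 2 * B / INR N.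
Proof.
  intros HN Ht H. assert (HN' : 0 < INR N) by now apply lt_0_INR.
  unfold fejer. set (v := avg N t (avg N t u)).
  replace (cis (- t) *: v 2%nat - cis t *: (cis (- t) *: v 1%nat))%V
    with (cis (- t) *: (v 2%nat - cis t *: v 1%nat))%V by vec.
  unfold v. rewrite avg_shift by auto.
  rewrite vnorm_cis, vscal_mul, vnorm_real, vnorm_cis by (apply Rlt_le, Rinv_0_lt_compat; auto).
  assert (A : forall m, (m <= S N)%nat -> |avg N t u m| <= B).
  { intros m Hm. apply avg_norm; auto. intros. apply H. lia. }
  assert (Q := vnorm_sub (avg N t u (1 + N)%nat) (avg N t u 1%nat)).
  assert (Q1 := A (1 + N)%nat ltac:(lia)). assert (Q2 := A 1%nat ltac:(lia)).
  unfold Rdiv. rewrite (Rmult_comm (2 * B)).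
  apply Rmult_le_compat_l. { apply Rlt_le, Rinv_0_lt_compat; auto. } lra.
Qed.

(** * Orbits of a linear operator *)

Section Orbits.
Variable T : X -> X.
Hypothesis T_add : forall x y, T (x + y)%V = (T x + T y)%V.
Hypothesis T_scal : forall c x, T (c *: x)%V = (c *: T x)%V.

Definition is_orbit v := forall m, v (S m) = T (v m).

(** The resolvent bound |(w - T)^(-1)| <= M, phrased as an inequality on vectors so that no inverse
    has to be carried along. *)
Definition bounded_below (w : Cx) (M : R) := forall x, |x| <= M * |(w *: x - T x)%V|.

Lemma T_vzero : T (vzero X) = vzero X.
Proof. rewrite <- (vscal_0 (vzero X)) at 1. rewrite T_scal. apply vscal_0. Qed.

Lemma T_bsum u n : T (bsum u n) = bsum (fun i => T (u i)) n.
Proof. apply bsum_morph; [apply T_vzero | apply T_add]. Qed.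

Lemma T_sub x y : T (x - y)%V = (T x - T y)%V.
Proof. rewrite !vopp_scal, T_add, T_scal. reflexivity. Qed.

Lemma avg_orbit N t v : is_orbit v -> is_orbit (avg N t v).
Proof.
  intros H m. unfold avg. rewrite T_scal, T_bsum. f_equal. apply bsum_ext.
  intros i Hi. rewrite T_scal, <- H. reflexivity.
Qed.

(** The vector on the right is (T - w)^2 [v m], so the lower bound is applied twice. *)
Lemma orbit_second_difference w M v m :
  0 <= M -> bounded_below w M -> is_orbit v ->
  |v m| <= M * M * |((v (S (S m)) - w *: v (S m)) - w *: (v (S m) - w *: v m))%V|.
Proof.
  intros HM Hw Hv.
  assert (D : forall x, |x| <= M * |(T x - w *: x)%V|).
  { intros x. rewrite <- vnorm_opp with (x := (T x - w *: x)%V).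
    replace (- (T x - w *: x))%V with (w *: x - T x)%V by vec. apply Hw. }
  eapply Rle_trans. { apply D. } rewrite Rmult_assoc. apply Rmult_le_compat_l; auto.
  eapply Rle_trans. { apply D. } rewrite T_sub, T_scal, <- !Hv. lra.
Qed.

(** Both averages telescope under (T - w)^2, which gains 1/N^2; undoing (T - w)^2 costs M^2. *)
Lemma fejer_far N t M u B :
  (0 < N)%nat -> cis (INR N * t) = Cx1 -> 0 <= M -> bounded_below (cis t) M ->
  is_orbit u -> (forall j, (j <= 2 * N + 2)%nat -> |u j| <= B) ->
  |(fejer N t u 1 - fejer N t u 0)%V| <= 8 * (M * M) * B / (INR N * INR N).
Proof.
  intros HN Ht HM Hw Hu H. assert (HN' : 0 < INR N) by now apply lt_0_INR.
  assert (Hi := Rinv_0_lt_compat _ HN').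
  unfold fejer. set (v := avg N t (avg N t u)).
  assert (Hv : is_orbit v) by (unfold v; now repeat apply avg_orbit).
  replace (cis (- t) *: v 2%nat - cis (- t) *: v 1%nat)%V
    with (cis (- t) *: (v 2%nat - v 1%nat))%V by vec.
  rewrite vnorm_cis.
  (* Up to a unimodular factor, [z 0] is (T - 1) H_w applied to the orbit. *)
  set (z := fun m => (v (S (S m)) - v (S m))%V).
  assert (Hz : is_orbit z).
  { intros m. unfold z. rewrite T_sub, <- !Hv. reflexivity. }
  change (|z O| <= 8 * (M * M) * B / (INR N * INR N)).
  eapply Rle_trans. { apply (orbit_second_difference (cis t) M z 0); auto. }
  set (g := Cmul (RtoC (/ INR N)) (cis t)).
  assert (dd : forall m, ((v (S (S m)) - cis t *: v (S m)) - cis t *: (v (S m) - cis t *: v m))%V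
     = (Cmul g g *: ((u (m + N + N)%nat - u (m + N)%nat) - (u (m + N)%nat - u m)))%V).
  { intros m. unfold v. rewrite !avg_shift by auto. fold g.
    replace (S m + N)%nat with (S (m + N)) by lia.
    transitivity (g *: ((avg N t u (S (m + N)) - cis t *: avg N t u (m + N)%nat)
       - (avg N t u (S m) - cis t *: avg N t u m)))%V. { vec. }
    rewrite !avg_shift by auto. fold g. vec. }
  assert (gn : Cmod (Cmul g g) = / INR N * / INR N).
  { unfold g. rewrite !Cmod_mul, Cmod_cis, Cmod_real, Rabs_pos_eq by lra. ring. }
  (* The case m = 2 reaches u at index 2 N + 2, whence the range in the hypothesis. The difference
     of the cases m = 2 and m = 1 then gives the constant 8. *)
  assert (ddn : forall m, (m <= 2)%nat ->
     |((v (S (S m)) - cis t *: v (S m)) - cis t *: (v (S m) - cis t *: v m))%V|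
     <= / INR N * / INR N * (4 * B)).
  { intros m Hm. rewrite dd, vnorm_scal, gn. apply Rmult_le_compat_l. { nra. }
    eapply Rle_trans. { apply vnorm_sub. }
    assert (Q1 := vnorm_sub (u (m + N + N)%nat) (u (m + N)%nat)).
    assert (Q2 := vnorm_sub (u (m + N)%nat) (u m)).
    assert (R1 := H (m + N + N)%nat ltac:(lia)). assert (R2 := H (m + N)%nat ltac:(lia)).
    assert (R3 := H m ltac:(lia)). lra. }
  match goal with |- M * M * ?E <= _ => assert (F : E <= / INR N * / INR N * (8 * B)) end.
  { unfold z.
    match goal with |- |?E| <= _ => replace E with
     (((v 4%nat - cis t *: v 3%nat) - cis t *: (v 3%nat - cis t *: v 2%nat))
      - ((v 3%nat - cis t *: v 2%nat) - cis t *: (v 2%nat - cis t *: v 1%nat)))%V by vec end.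
    eapply Rle_trans. { apply vnorm_sub. }
    assert (Q1 := ddn 2%nat ltac:(lia)). assert (Q2 := ddn 1%nat ltac:(lia)). lra. }
  apply (Rmult_le_compat_l (M * M)) in F. 2: nra.
  eapply Rle_trans. { apply F. } right. field. lra.
Qed.

(** All sums are expanded and those over s and t moved inside, so [near_coef] appears as the
    coefficient of [u (S i + l)]. For fixed i the index runs over N consecutive values, and
    [near_coef_sum] applies with p = i + 1. *)
Lemma fejer_near N D u B :
  (0 < D)%nat -> (3 * D <= N)%nat -> (forall j, (j <= 2 * N)%nat -> |u j| <= B) ->
  |bsum (fun s => bsum (fun t =>
     Csub (cis (angle N D s t)) Cx1 *: fejer N (angle N D s t) u 0)%V (3 * D)) D|
  <= 6 * INR D * (2 * PI * INR D / INR N) * B.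
Proof.
  intros HD HN H. assert (HN' : 0 < INR N) by (apply lt_0_INR; lia).
  assert (HB : 0 <= B) by (eapply Rle_trans; [apply vnorm_nonneg | apply (H O); lia]).
  assert (Hi := Rinv_0_lt_compat _ HN').
  rewrite (bsum_ext _ (fun s => RtoC (/ INR N * / INR N) *: bsum (fun t =>
    bsum (fun i => bsum (fun l => (Cmul (Csub (cis (angle N D s t)) Cx1)
      (cis (- (INR (S i + l) * angle N D s t)))) *: u (S i + l)%nat) N) N) (3 * D))%V).
  2: { intros s Hs. rewrite <- bsum_vscal. apply bsum_ext. intros t Ht.
    rewrite fejer_expand, <- !vscal_mul.
    replace (Cmul (Csub (cis (angle N D s t)) Cx1) (RtoC (/ INR N * / INR N)))
      with (Cmul (RtoC (/ INR N * / INR N)) (Csub (cis (angle N D s t)) Cx1)) by ring.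
    rewrite vscal_mul. f_equal. rewrite <- bsum_vscal. apply bsum_ext. intros i _.
    rewrite <- bsum_vscal. apply bsum_ext. intros l _. now rewrite vscal_mul. }
  rewrite bsum_vscal, bsum_exchange_pairs, vnorm_real by nra.
  apply Rle_trans with (/ INR N * / INR N * (INR N *
     (6 * INR N * INR D * (2 * PI * INR D / INR N) * B))).
  2: { right. field. lra. }
  apply Rmult_le_compat_l. { nra. }
  apply vnorm_bsum_bound. intros i Hi'.
  eapply Rle_trans. { apply vnorm_bsum. }
  apply Rle_trans with (bsum (fun l => B * Cmod (near_coef N D (S i + l))) N).
  - apply rsum_le. intros l Hl.
    rewrite (bsum_ext _ (fun s => bsum (fun t => Cmul (Csub (cis (angle N D s t)) Cx1)
      (cis (- (INR (S i + l) * angle N D s t)))) (3 * D) *: u (S i + l)%nat)%V).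
    2: { intros. now rewrite bsum_vscal_r. }
    rewrite bsum_vscal_r, vnorm_scal. fold (near_coef N D (S i + l)).
    rewrite Rmult_comm. apply Rmult_le_compat_r. { apply Cmod_nonneg. } apply H. lia.
  - rewrite rsum_scal, (Rmult_comm B). apply Rmult_le_compat_r; auto.
    apply near_coef_sum; auto.
Qed.

Lemma cis_angle_period N D s t : (0 < N)%nat -> cis (INR N * angle N D s t) = Cx1.
Proof.
  intros HN. assert (HN' : 0 < INR N) by (apply lt_0_INR; lia).
  unfold angle.
  replace (INR N * _) with
   (2 * PI * INR t + (2 * PI * INR s + - (2 * PI * INR (2 * D)))) by (field; lra).
  rewrite !cis_add, !cis_period_nat, cis_period_nat_opp. ring.
Qed.

(** For these t the offset t + s - 2 D lies between D and N - D: no rotation s < D brings a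
    remaining root closer than D steps to 1. *)
Lemma angle_far N D s t :
  (s < D)%nat -> (3 * D <= t)%nat -> (t < N)%nat ->
  2 * PI * INR D / INR N <= angle N D s t <= 2 * PI - 2 * PI * INR D / INR N.
Proof.
  intros Hs Ht HtN. assert (HN' : 0 < INR N) by (apply lt_0_INR; lia).
  assert (HP := PI_RGT_0). assert (Hc : 0 < 2 * PI / INR N) by (apply Rdiv_lt_0_compat; lra).
  unfold angle. rewrite mult_INR. simpl (INR 2).
  apply le_INR in Ht. rewrite mult_INR in Ht. simpl (INR 3) in Ht.
  apply lt_INR in Hs. apply lt_INR in HtN. assert (H0 := pos_INR s).
  replace (2 * PI * INR D / INR N) with (2 * PI / INR N * INR D) by (field; lra).
  replace (2 * PI * INR t / INR N + (2 * PI * INR s / INR N + - (2 * PI * ((1 + 1) * INR D) / INR N)))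
   with (2 * PI / INR N * (INR t + INR s - 2 * INR D)) by (field; lra).
  assert (E : 2 * PI = 2 * PI / INR N * INR N) by (field; lra).
  set (c := 2 * PI / INR N) in *. rewrite E. split; nra.
Qed.

(* With [N = L D], [L] fixed and [D] large, the [3 D] nearest roots of unity fill an arc of fixed
   small length around [1], and the remaining ones stay where the resolvent is bounded. *)
Lemma orbit_increment N D M u B :
  (0 < D)%nat -> (3 * D <= N)%nat -> 0 <= M ->
  (forall t, 2 * PI * INR D / INR N <= t <= 2 * PI - 2 * PI * INR D / INR N ->
     bounded_below (cis t) M) ->
  is_orbit u -> (forall j, (j <= 2 * N + 2)%nat -> |u j| <= B) ->
  |(u (S N) - u N)%V| <=
  (8 * (M * M) / INR N + (6 + 12 * PI) * INR D / INR N) * B.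
Proof.
  intros HD HN HM Hw Hu H. assert (HN' : 0 < INR N) by (apply lt_0_INR; lia).
  assert (HD' : 0 < INR D) by (apply lt_0_INR; lia).
  assert (HB : 0 <= B) by (eapply Rle_trans; [apply vnorm_nonneg | apply (H O); lia]).
  assert (Hi := Rinv_0_lt_compat _ HN').
  set (th := angle N D).
  (* Every rotation s resolves the same increment; the second resolution is applied to the shifted
     sequence. *)
  assert (res : forall s, bsum (fun t => fejer N (th s t) u 1 - fejer N (th s t) u 0)%V N =
                   (u (S N) - u N)%V).
  { intros s. rewrite bsum_vsub. f_equal; [|f_equal].
    - change (bsum (fun t => fejer N (th s t) (fun j => u (S j)) 0) N = u (S N)).
      unfold th, angle. rewrite (fejer_resolution N _ (fun j => u (S j))); auto. { lia. }
      generalize (cis_angle_period N D s 0 ltac:(lia)). unfold angle. simpl (INR 0).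
      intros <-. f_equal. field. lra.
    - unfold th, angle. apply fejer_resolution. { lia. }
      generalize (cis_angle_period N D s 0 ltac:(lia)). unfold angle. simpl (INR 0).
      intros <-. f_equal. field. lra. }
  (* Multiplying by D turns the increment into a sum over the D rotations. Each summand is then cut
     into near roots with T - w, far roots with T - 1, and near roots with w - 1. *)
  apply (Rmult_le_reg_l (INR D)); auto.
  rewrite <- vnorm_real by lra. rewrite <- csum_one, <- bsum_vscal_r.
  rewrite (bsum_ext _ (fun s =>
      (bsum (fun t => fejer N (th s t) u 1 - cis (th s t) *: fejer N (th s t) u 0) (3 * D)
       + bsum (fun t => fejer N (th s (3 * D + t)%nat) u 1 - fejer N (th s (3 * D + t)%nat) u 0) (N - 3 * D))
       + bsum (fun t => Csub (cis (th s t)) Cx1 *: fejer N (th s t) u 0) (3 * D))%V).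
  2: { intros s Hs. rewrite vscal_1, <- (res s).
       assert (cut : forall f : nat -> X, bsum f N =
         madd (bsum f (3 * D)) (bsum (fun i => f (3 * D + i)%nat) (N - 3 * D)))
         by (intros f; rewrite <- bsum_cat; f_equal; lia).
       rewrite cut. change (@madd X _) with (vadd X).
       rewrite (bsum_ext _ (fun t => (fejer N (th s t) u 1 - cis (th s t) *: fejer N (th s t) u 0)
         + Csub (cis (th s t)) Cx1 *: fejer N (th s t) u 0)%V (3 * D)) by (intros; vec).
       rewrite bsum_vadd. vec. }
  rewrite bsum_vadd. eapply Rle_trans. { apply vnorm_triangle. }
  assert (E1 := fejer_near N D u B HD HN ltac:(intros; apply H; lia)). fold th in E1.
  match goal with |- |?P| + _ <= _ =>
   assert (E2 : |P| <= INR D * (INR (3 * D) * (2 * B / INR N) +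
        INR (N - 3 * D) * (8 * (M * M) * B / (INR N * INR N)))) end.
  { apply vnorm_bsum_bound. intros s Hs. eapply Rle_trans. { apply vnorm_triangle. }
    apply Rplus_le_compat; apply vnorm_bsum_bound; intros t Ht.
    - apply fejer_shift_norm; try lia. { apply cis_angle_period; lia. } intros; apply H; lia.
    - apply fejer_far; auto; try lia. { apply cis_angle_period; lia. }
      apply Hw. apply angle_far; lia. }
  assert (E3 : INR (N - 3 * D) <= INR N) by (apply le_INR; lia).
  assert (E4 : 0 <= 8 * (M * M) * B / (INR N * INR N)).
  { apply Rmult_le_pos. { apply Rmult_le_pos; nra. } apply Rlt_le, Rinv_0_lt_compat; nra. }
  apply (Rmult_le_compat_r _ _ _ E4) in E3.
  rewrite mult_INR in E2. simpl (INR 3) in E2.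
  apply Rle_trans with (INR D * ((1 + 1 + 1) * INR D * (2 * B / INR N) +
        INR N * (8 * (M * M) * B / (INR N * INR N))) + 6 * INR D * (2 * PI * INR D / INR N) * B).
  - apply Rplus_le_compat; auto. eapply Rle_trans. { apply E2. }
    apply Rmult_le_compat_l; lra.
  - right. field. lra.
Qed.

(** * Uniform resolvent bounds and the finite Katznelson-Tzafriri estimate *)

Lemma bounded_below_perturb w w' M :
  0 < M -> bounded_below w M -> Cmod (Csub w w') <= / (2 * M) -> bounded_below w' (2 * M).
Proof.
  intros HM Hw Hd x.
  assert (H := Hw x).
  (* After multiplication by M the perturbation costs at most |x|/2, which is absorbed on the
     left. *)
  assert (E : |(w *: x - T x)%V| <= |(w' *: x - T x)%V| + / (2 * M) * |x|).
  { replace (w *: x - T x)%V with ((w' *: x - T x) + Csub w w' *: x)%V by vec.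
    eapply Rle_trans. { apply vnorm_triangle. } rewrite vnorm_scal.
    apply Rplus_le_compat_l. apply Rmult_le_compat_r; auto. apply vnorm_nonneg. }
  apply (Rmult_le_compat_l M) in E. 2: lra.
  replace (M * (|(w' *: x - T x)%V| + / (2 * M) * |x|)) with
    (M * |(w' *: x - T x)%V| + |x| / 2) in E by (field; lra). lra.
Qed.

Lemma bounded_below_mono w M M' : M <= M' -> bounded_below w M -> bounded_below w M'.
Proof.
  intros HM Hw x. eapply Rle_trans. { apply Hw. }
  apply Rmult_le_compat_r; auto. apply vnorm_nonneg.
Qed.

Lemma bounded_below_uniform del :
  (forall t, 0 < t < 2 * PI -> exists M, 0 < M /\ bounded_below (cis t) M) ->
  0 < del ->
  exists M, 0 <= M /\ forall t, del <= t <= 2 * PI - del -> bounded_below (cis t) M.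
Proof.
  intros H Hdel.
  assert (C : forall t, {M : R | 0 < M /\ (0 < t < 2 * PI -> bounded_below (cis t) M)}).
  { intros t. apply constructive_indefinite_description.
    destruct (classic (0 < t < 2 * PI)) as [h|h].
    (* Inside the interval a genuine bound is chosen; elsewhere 1 is a placeholder keeping the radii
       positive. *)
    - destruct (H t h) as [M HM]. exists M. tauto.
    - exists 1. split; [lra|tauto]. }
  set (f := fun t => proj1_sig (C t)).
  assert (fpos : forall t, 0 < f t) by (intros; unfold f; apply (proj2_sig (C t))).
  assert (dpos : forall t, 0 < / (2 * f t)).
  { intros t. assert (h := fpos t). apply Rinv_0_lt_compat. lra. }
  destruct (Compactness.compactness_value_1d del (2 * PI - del)
     (fun t => mkposreal _ (dpos t))) as [d Hd].
  assert (d0 := cond_pos d).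
  (* Compactness puts each x within [/ (2 * f t)] of some t whose radius is at least d. The
     perturbed bound [2 * f t] is then at most [/ d]. *)
  exists (/ d). split. { apply Rlt_le, Rinv_0_lt_compat; auto. }
  intros x Hx. apply NNPP. intros Hn. apply (Hd x Hx). intros [t [Ht [Hxt Hdt]]].
  simpl in Hxt, Hdt. apply Hn. clear Hn.
  assert (fp := fpos t).
  apply bounded_below_mono with (2 * f t).
  - apply Rinv_le_contravar in Hdt; auto. now rewrite Rinv_inv in Hdt.
  - apply bounded_below_perturb with (cis t); auto.
    + unfold f. apply (proj2_sig (C t)). lra.
    + replace (Csub (cis t) (cis x)) with (Cmul (cis x) (Csub (cis (t - x)) Cx1)).
      * rewrite Cmod_mul, Cmod_cis, Rmult_1_l. eapply Rle_trans. { apply Cmod_cis_sub1. }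
        rewrite Rabs_minus_sym. lra.
      * replace t with (x + (t - x)) at 2 by ring. rewrite cis_add. ring.
Qed.

(** N depends only on T and eps, not on the orbit or on B. The order of choice is L for the arc,
    then M by compactness off that arc, then D. *)
Lemma finite_katznelson_tzafriri :
  (forall t, 0 < t < 2 * PI -> exists M, 0 < M /\ bounded_below (cis t) M) ->
  forall eps, 0 < eps -> exists N, forall u B,
    is_orbit u -> (forall j, (j <= 2 * N + 2)%nat -> |u j| <= B) ->
    |(u (S N) - u N)%V| <= eps * B.
Proof.
  intros H eps He.
  assert (HP := PI_RGT_0). assert (HP4 := PI_4).
  (* Since pi <= 4, 6 + 12 pi <= 54, so the arc term is at most eps/2; L > 3 leaves room for the 3 D
     near roots. *)
  destruct (INR_unbounded (3 + 108 / eps)) as [L HL].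
  assert (0 < 108 / eps) by (apply Rdiv_lt_0_compat; lra).
  assert (HL3 : (3 < L)%nat) by (apply INR_lt; simpl (INR 3); lra).
  destruct (bounded_below_uniform (2 * PI / INR L) H) as [M [HM Hw]].
  { apply Rdiv_lt_0_compat; lra. }
  (* This makes the far term 8 M^2 / (L D) at most eps/2. *)
  destruct (INR_unbounded (1 + 16 * (M * M) / eps)) as [D HD].
  assert (0 <= 16 * (M * M) / eps).
  { apply Rmult_le_pos. { nra. } apply Rlt_le, Rinv_0_lt_compat; auto. }
  assert (HD0 : (0 < D)%nat) by (apply INR_lt; simpl (INR 0); lra).
  exists (L * D)%nat. intros u B Hu HB.
  assert (B0 : 0 <= B) by (eapply Rle_trans; [apply vnorm_nonneg | apply (HB O); lia]).
  eapply Rle_trans. { apply (orbit_increment (L * D) D M u B); auto. { nia. }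
    intros t Ht. apply Hw. rewrite mult_INR in Ht.
    replace (2 * PI * INR D / (INR L * INR D)) with (2 * PI / INR L) in Ht by (field; lra).
    exact Ht. }
  apply Rmult_le_compat_r; auto. rewrite mult_INR.
  replace ((6 + 12 * PI) * INR D / (INR L * INR D)) with ((6 + 12 * PI) / INR L) by (field; lra).
  assert (E1 : (6 + 12 * PI) / INR L <= eps / 2).
  { apply (Rmult_le_reg_r (INR L)). { lra. } unfold Rdiv at 1. rewrite Rmult_assoc, Rinv_l by lra.
    assert (108 / eps * eps = 108) by (field; lra). nra. }
  assert (E2 : 8 * (M * M) / (INR L * INR D) <= eps / 2).
  { apply (Rmult_le_reg_r (INR L * INR D)). { nra. }
    unfold Rdiv at 1. rewrite Rmult_assoc, Rinv_l by nra.
    assert (16 * (M * M) / eps * eps = 16 * (M * M)) by (field; lra).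
    assert (INR D * eps >= 16 * (M * M)) by nra.
    assert (INR L * (INR D * eps) >= INR D * eps) by nra. nra. }
  lra.
Qed.

(** * Cesàro sums of powers *)

Definition ces (g : R) (n : nat) x : X :=
  bsum (fun j => RtoC (kcoef g (n - j)) *: opow X T j x)%V (S n).

Lemma vsum_bsum u n : vsum X u n = bsum u (S n).
Proof.
  induction n.
  - simpl. now rewrite vadd_0.
  - cbn [vsum]. rewrite IHn. reflexivity.
Qed.

Lemma Mop_ces g n x : Mop X T g n x = (RtoC (/ kcoef (g + 1) n) *: ces g n x)%V.
Proof. unfold Mop. now rewrite vsum_bsum. Qed.

Lemma ces_0 g x : ces g 0 x = x.
Proof. unfold ces. simpl. rewrite vadd_0. apply vscal_1. Qed.

Lemma ces_succ g n x :
  ces g (S n) x = (T (ces g n x) + RtoC (kcoef g (S n)) *: x)%V.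
Proof.
  unfold ces. rewrite bsum_first, T_bsum. change (@madd X _) with (vadd X).
  rewrite vadd_comm. f_equal. apply bsum_ext. intros j Hj. now rewrite T_scal.
Qed.

Lemma ces_pascal g n x :
  ces (g + 1) (S n) x = (ces (g + 1) n x + ces g (S n) x)%V.
Proof.
  unfold ces. change (vadd X) with (@madd X _).
  change (bsum (fun j => (RtoC (kcoef (g + 1) (S n - j)) *: opow X T j x)%V) (S (S n))) with
    (madd (bsum (fun j => (RtoC (kcoef (g + 1) (S n - j)) *: opow X T j x)%V) (S n))
       (RtoC (kcoef (g + 1) (S n - S n)) *: opow X T (S n) x)%V).
  change (bsum (fun j => (RtoC (kcoef g (S n - j)) *: opow X T j x)%V) (S (S n))) with
    (madd (bsum (fun j => (RtoC (kcoef g (S n - j)) *: opow X T j x)%V) (S n))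
       (RtoC (kcoef g (S n - S n)) *: opow X T (S n) x)%V).
  rewrite madd_assoc, <- bsum_add, Nat.sub_diag. f_equal.
  apply bsum_ext. intros j Hj. rewrite Nat.sub_succ_l by lia.
  rewrite kcoef_pascal, RtoC_add. apply vscal_addc.
Qed.

(** [ces b] is the convolution of k^b with the powers of T, and k^(-b) is the convolution inverse of
    k^b because k^0 is the unit. *)
Lemma opow_ces b n x :
  opow X T n x = bsum (fun j => RtoC (kcoef (- b) j) *: ces b (n - j) x)%V (S n).
Proof.
  rewrite (bsum_ext _ (fun j => bsum (fun i =>
    RtoC (kcoef (- b) j * kcoef b (n - i - j)) *: opow X T i x)%V (S n - j))).
  2: { intros j Hj. unfold ces. rewrite <- bsum_vscal. rewrite Nat.sub_succ_l by lia.
       apply bsum_ext. intros i Hi. rewrite RtoC_mul, vscal_mul.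
       do 4 f_equal. lia. }
  rewrite (bsum_triangle (fun j i =>
    (RtoC (kcoef (- b) j * kcoef b (n - i - j)) *: opow X T i x)%V)).
  assert (inner : forall i, (i < S n)%nat ->
    bsum (fun j => RtoC (kcoef (- b) j * kcoef b (n - i - j)) *: opow X T i x)%V (S n - i) =
    (RtoC (kcoef 0 (n - i)) *: opow X T i x)%V).
  { intros i Hi. rewrite bsum_vscal_r, <- RtoC_bsum, Nat.sub_succ_l by lia.
    rewrite kcoef_vandermonde. do 3 f_equal. ring. }
  rewrite (bsum_single _ (S n) n); try lia.
  - rewrite inner, Nat.sub_diag by lia. symmetry. apply vscal_1.
  - intros i Hi Hne. rewrite inner by lia.
    replace (n - i)%nat with (S (n - i - 1)) by lia. rewrite kcoef_0_succ. apply vscal_0.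
Qed.

(** * Growth of Cesàro sums under a Cesàro bound *)

Section CesaroBounded.
Variables (a K M : R).
Hypothesis Ha : 0 < a.
Hypothesis HK : 0 <= K.
Hypothesis HM : 0 <= M.
Hypothesis T_bound : forall x, |T x| <= M * |x|.
Hypothesis ces_bound : forall n x, |ces a n x| <= K * kcoef (a + 1) n * |x|.

(** Iterating [ces_succ] j times leaves errors built from k^a(n+i), 1 <= i <= j, each of order
    k^(a+1)(n)/n. *)
Lemma ces_shift j :
  exists c, 0 <= c /\ forall n x, (1 <= n)%nat ->
    |(ces a (n + j) x - opow X T j (ces a n x))%V| <= c / INR n * kcoef (a + 1) n * |x|.
Proof.
  induction j as [|j [c [Hc IH]]].
  - exists 0. split. { lra. } intros n x Hn. rewrite Nat.add_0_r. simpl.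
    rewrite vadd_opp, vnorm_vzero. unfold Rdiv. lra.
  - destruct (kcoef_shift a (S j)) as [d [Hd Hs]]. { lra. }
    (* T multiplies the previous error by at most M; the new term is bounded through [kcoef_ratio]
       and [kcoef_shift]. *)
    exists (M * c + a * (1 + d)). split. { nra. } intros n x Hn.
    rewrite Nat.add_succ_r, ces_succ. cbn [opow].
    replace (T (ces a (n + j) x) + RtoC (kcoef a (S (n + j))) *: x - T (opow X T j (ces a n x)))%V
     with (T (ces a (n + j) x - opow X T j (ces a n x)) + RtoC (kcoef a (S (n + j))) *: x)%V
     by (rewrite T_sub; vec).
    eapply Rle_trans. { apply vnorm_triangle. }
    assert (kp : 0 < kcoef a (S (n + j))) by now apply kcoef_pos.
    rewrite vnorm_real by lra.
    assert (Hn' : 1 <= INR n) by (apply (le_INR 1); auto).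
    assert (Hi : 0 < / INR n <= 1).
    { split. { apply Rinv_0_lt_compat; lra. } rewrite <- Rinv_1. apply Rinv_le_contravar; lra. }
    assert (k0 : 0 < kcoef (a + 1) n) by (apply kcoef_pos; lra).
    assert (x0 := vnorm_nonneg x).
    assert (E1 : |T (ces a (n + j) x - opow X T j (ces a n x))%V| <=
       M * (c / INR n * kcoef (a + 1) n * |x|)).
    { eapply Rle_trans. { apply T_bound. } apply Rmult_le_compat_l; auto. }
    assert (E2 : kcoef a (S (n + j)) <= a * (1 + d) / INR n * kcoef (a + 1) n).
    { assert (R := kcoef_ratio a (S (n + j))). specialize (Hs n Hn).
      rewrite Nat.add_succ_r in Hs.
      assert (Hm : INR n <= INR (S (n + j))) by (apply le_INR; lia).
      apply (Rmult_le_reg_r (INR n)). { lra. }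
      replace (a * (1 + d) / INR n * kcoef (a + 1) n * INR n)
        with (a * (1 + d) * kcoef (a + 1) n) by (field; lra).
      apply Rle_trans with (kcoef (a + 1) (S (n + j)) * a). { rewrite R. nra. }
      apply Rle_trans with ((1 + d / INR n) * kcoef (a + 1) n * a).
      { apply Rmult_le_compat_r; lra. }
      replace ((1 + d / INR n) * kcoef (a + 1) n * a) with (a * (1 + d / INR n) * kcoef (a + 1) n) by ring.
      apply Rmult_le_compat_r. { lra. } apply Rmult_le_compat_l. { lra. }
      unfold Rdiv. nra. }
    apply (Rmult_le_compat_r _ _ _ x0) in E2.
    apply Rle_trans with (M * (c / INR n * kcoef (a + 1) n * |x|) +
      a * (1 + d) / INR n * kcoef (a + 1) n * |x|). { lra. }
    right. field. lra.
Qed.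

(** Only the threshold depends on J, never the constant 2 K + 1. Its 2 K bounds the sum at n + j,
    where k^(a+1) has at most doubled, and its 1 bounds the error of the shift. *)
Lemma ces_orbit_eventually eta :
  0 < eta -> forall J, exists n0, forall n, (n0 <= n)%nat -> forall j, (j <= J)%nat ->
  (forall x, |(ces a (n + j) x - opow X T j (ces a n x))%V| <= eta * kcoef (a + 1) n * |x|) /\
  (forall x, |opow X T j (ces a n x)| <= (2 * K + 1) * kcoef (a + 1) n * |x|).
Proof.
  intros He. apply eventually_forall_le. intros j.
  destruct (ces_shift j) as [c [Hc Hsh]].
  destruct (kcoef_shift a j) as [d [Hd Hk]]. { lra. }
  destruct (eventually_div_le c (Rmin eta 1)) as [n1 [H11 H1]]. { apply Rmin_glb_lt; lra. }
  destruct (eventually_div_le d 1) as [n2 [H21 H2]]. { lra. }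
  exists (Nat.max n1 n2). intros n Hn.
  assert (k0 : 0 < kcoef (a + 1) n) by (apply kcoef_pos; lra).
  assert (S1 : forall x, |(ces a (n + j) x - opow X T j (ces a n x))%V|
      <= Rmin eta 1 * kcoef (a + 1) n * |x|).
  { intros x. eapply Rle_trans. { apply Hsh. lia. }
    apply Rmult_le_compat_r. { apply vnorm_nonneg. }
    apply Rmult_le_compat_r. { lra. } apply H1. lia. }
  split; intros x; assert (x0 := vnorm_nonneg x).
  - eapply Rle_trans. { apply S1. } apply Rmult_le_compat_r; auto.
    apply Rmult_le_compat_r. { lra. } apply Rmin_l.
  - replace (opow X T j (ces a n x)) with
      (ces a (n + j) x - (ces a (n + j) x - opow X T j (ces a n x)))%V by vec.
    eapply Rle_trans. { apply vnorm_sub. }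
    assert (Q := S1 x). assert (Q' := ces_bound (n + j) x).
    assert (Hk' : kcoef (a + 1) (n + j) <= 2 * kcoef (a + 1) n).
    { eapply Rle_trans. { apply Hk. lia. } apply Rmult_le_compat_r. { lra. }
      assert (h := H2 n ltac:(lia)). lra. }
    assert (kx : 0 <= kcoef (a + 1) n * |x|) by (apply Rmult_le_pos; lra).
    assert (E1 : Rmin eta 1 * kcoef (a + 1) n * |x| <= 1 * kcoef (a + 1) n * |x|).
    { rewrite !Rmult_assoc. apply Rmult_le_compat_r; auto. apply Rmin_r. }
    assert (E2 : K * kcoef (a + 1) (n + j) * |x| <= K * (2 * kcoef (a + 1) n) * |x|).
    { apply Rmult_le_compat_r; auto. apply Rmult_le_compat_l; auto. }
    lra.
Qed.

Lemma ces_increment_bound :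
  (forall t, 0 < t < 2 * PI -> exists M, 0 < M /\ bounded_below (cis t) M) ->
  forall eps, 0 < eps -> exists n0, forall n x, (n0 <= n)%nat ->
    |ces (a - 1) n x| <= eps * kcoef (a + 1) n * |x|.
Proof.
  intros Hw eps He.
  assert (HK1 : 0 < 2 * (2 * K + 1)) by lra.
  (* N is fixed before the threshold. The increment then costs eps/2, and replacing the two
     neighbouring sums by points of the orbit costs eps/4 each. *)
  destruct (finite_katznelson_tzafriri Hw (eps / (2 * (2 * K + 1)))) as [N HN].
  { apply Rdiv_lt_0_compat; lra. }
  destruct (ces_orbit_eventually (eps / 4) ltac:(lra) (2 * N + 2)%nat) as [n0 Hn0].
  exists (n0 + S N)%nat. intros m x Hm.
  set (n := (m - S N)%nat). assert (Hn : (n0 <= n)%nat) by (unfold n; lia).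
  replace m with (n + S N)%nat by (unfold n; lia). rewrite Nat.add_succ_r.
  assert (P := ces_pascal (a - 1) (n + N) x). replace (a - 1 + 1) with a in P by ring.
  set (u := fun j => opow X T j (ces a n x)).
  assert (E : ces (a - 1) (S (n + N)) x =
    ((ces a (n + S N) x - u (S N)) - (ces a (n + N) x - u N) + (u (S N) - u N))%V).
  { rewrite Nat.add_succ_r, P. vec. }
  rewrite E. clear E P.
  assert (x0 := vnorm_nonneg x).
  assert (k0 : 0 < kcoef (a + 1) n) by (apply kcoef_pos; lra).
  assert (B1 := proj1 (Hn0 n Hn (S N) ltac:(lia)) x).
  assert (B2 := proj1 (Hn0 n Hn N ltac:(lia)) x).
  assert (B3 : |(u (S N) - u N)%V| <=
     eps / (2 * (2 * K + 1)) * ((2 * K + 1) * kcoef (a + 1) n * |x|)).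
  { apply HN. { intros j. reflexivity. }
    intros j Hj. exact (proj2 (Hn0 n Hn j Hj) x). }
  replace (eps / (2 * (2 * K + 1)) * ((2 * K + 1) * kcoef (a + 1) n * |x|)) with
    (eps / 2 * kcoef (a + 1) n * |x|) in B3 by (field; lra).
  fold (u (S N)) in B1. fold (u N) in B2.
  eapply Rle_trans. { apply vnorm_triangle. }
  assert (B4 := vnorm_sub (ces a (n + S N) x - u (S N))%V (ces a (n + N) x - u N)%V).
  apply Rle_trans with (eps * kcoef (a + 1) n * |x|). { lra. }
  apply Rmult_le_compat_r; auto. apply Rmult_le_compat_l. { lra. }
  apply kcoef_mono; [lra|lia].
Qed.

(** A bound for every n, serving the indices below the threshold of the sharp estimate. The
    difference of two neighbouring sums gives 2 K; the 1 covers n = 0. *)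
Lemma ces_pred_bound n x :
  |ces (a - 1) n x| <= (2 * K + 1) * kcoef (a + 1) n * |x|.
Proof.
  assert (x0 := vnorm_nonneg x). destruct n as [|n].
  - rewrite ces_0. simpl. nra.
  - assert (P := ces_pascal (a - 1) n x). replace (a - 1 + 1) with a in P by ring.
    replace (ces (a - 1) (S n) x) with (ces a (S n) x - ces a n x)%V by (rewrite P; vec).
    eapply Rle_trans. { apply vnorm_sub. }
    assert (Q1 := ces_bound n x). assert (Q2 := ces_bound (S n) x).
    assert (k0 : 0 < kcoef (a + 1) n) by (apply kcoef_pos; lra).
    assert (km := kcoef_mono a n (S n) ltac:(lra) ltac:(lia)).
    assert (K * kcoef (a + 1) n * |x| <= K * kcoef (a + 1) (S n) * |x|).
    { apply Rmult_le_compat_r; auto. apply Rmult_le_compat_l; auto. }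
    assert (0 <= kcoef (a + 1) (S n) * |x|) by (apply Rmult_le_pos; lra). lra.
Qed.

End CesaroBounded.

Lemma spectrum_bounded_below :
  (forall lam : Cx, Cmod lam = 1 -> in_spectrum X T lam -> lam = Cx1) ->
  forall t, 0 < t < 2 * PI -> exists M, 0 < M /\ bounded_below (cis t) M.
Proof.
  intros H t Ht.
  assert (I : invertible X (fun x => cis t *: x - T x)%V).
  { apply NNPP. intros Hn. apply (cis_ne_1 t Ht). apply H. { apply Cmod_cis. } exact Hn. }
  destruct I as [Q [[_ [_ [M HQ]]] [HQ1 _]]].
  (* M bounds the inverse but may fail to be positive, hence the maximum. *)
  exists (Rmax M 1). split. { apply Rlt_le_trans with 1; [lra|apply Rmax_r]. }
  intros x. rewrite <- (HQ1 x) at 1. eapply Rle_trans. { apply HQ. }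
  apply Rmult_le_compat_r. { apply vnorm_nonneg. } apply Rmax_l.
Qed.

End Orbits.
End Banach.

(** * Growth of the lower-order Cesàro means and of the powers *)

Theorem theorem4p3 (X : CBanach) (alpha : R) (T : X -> X)
  (Halpha : 1 <= alpha)
  (HT : is_bounded_linear X T)
  (Hces : Cesaro_bounded X T alpha)
  (Hspec : forall lam : Cx, Cmod lam = 1 -> in_spectrum X T lam -> lam = Cx1) :
  (forall eps, 0 < eps -> exists N : nat, forall n : nat, (N <= n)%nat ->
     opnorm_le X (Mop X T (alpha - 1) n) (eps * INR n)) /\
  (forall eps, 0 < eps -> exists N : nat, forall n : nat, (N <= n)%nat ->
     opnorm_le X (opow X T n) (eps * Rpower (INR n) alpha)).
Proof.
  destruct HT as [T_add [T_scal [M0 HM0]]]. destruct Hces as [K0 HK0].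
  set (K := Rmax K0 0). set (M := Rmax M0 0).
  assert (HK : 0 <= K) by apply Rmax_r. assert (HM : 0 <= M) by apply Rmax_r.
  assert (T_bound : forall x, vnorm X (T x) <= M * vnorm X x).
  { intros x. eapply Rle_trans. { apply HM0. }
    apply Rmult_le_compat_r. { apply vnorm_nonneg. } apply Rmax_l. }
  assert (kpos : forall n, 0 < kcoef (alpha + 1) n) by (intros; apply kcoef_pos; lra).
  assert (ces_bound : forall n x,
    vnorm X (ces X T alpha n x) <= K * kcoef (alpha + 1) n * vnorm X x).
  { intros n x. assert (H := HK0 n x). rewrite Mop_ces in H.
    assert (k0 := kpos n).
    rewrite vnorm_real in H by (apply Rlt_le, Rinv_0_lt_compat; auto).
    apply (Rmult_le_compat_l (kcoef (alpha + 1) n)) in H. 2: lra.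
    rewrite <- Rmult_assoc, Rinv_r, Rmult_1_l in H by lra.
    eapply Rle_trans. { apply H. }
    assert (K0 <= K) by apply Rmax_l.
    rewrite <- Rmult_assoc, (Rmult_comm _ K0). apply Rmult_le_compat_r. { apply vnorm_nonneg. }
    apply Rmult_le_compat_r; lra. }
  assert (small := ces_increment_bound X T T_add T_scal alpha K M ltac:(lra) HK HM T_bound ces_bound
    (spectrum_bounded_below X T Hspec)).
  assert (crude := ces_pred_bound X T alpha K ltac:(lra) HK ces_bound).
  split; intros eps He.
  (* The quotient k^(alpha+1)(n) / k^alpha(n) is 1 + n/alpha, at most 2 n for n >= 1, which explains
     eps/2. *)
  - destruct (small (eps / 2) ltac:(lra)) as [n0 Hn0].
    exists (S n0). intros n Hn x. assert (x0 := vnorm_nonneg X x).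
    assert (Hn' : 1 <= INR n) by (apply (le_INR 1); lia).
    rewrite Mop_ces. replace (alpha - 1 + 1) with alpha by ring.
    assert (ka : 0 < kcoef alpha n) by (apply kcoef_pos; lra).
    assert (ki := Rinv_0_lt_compat _ ka).
    rewrite vnorm_real by lra.
    assert (H := Hn0 n x ltac:(lia)).
    apply Rle_trans with (/ kcoef alpha n * (eps / 2 * kcoef (alpha + 1) n * vnorm X x)).
    { apply Rmult_le_compat_l; lra. }
    assert (R := kcoef_ratio alpha n).
    replace (kcoef (alpha + 1) n) with (kcoef alpha n * (alpha + INR n) / alpha)
      by (rewrite <- R; field; lra).
    replace (/ kcoef alpha n * (eps / 2 * (kcoef alpha n * (alpha + INR n) / alpha) * vnorm X x))
      with (eps / 2 * (1 + INR n / alpha) * vnorm X x) by (field; lra).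
    apply Rmult_le_compat_r; auto.
    assert (INR n / alpha <= INR n).
    { apply (Rmult_le_reg_r alpha). { lra. } unfold Rdiv. rewrite Rmult_assoc, Rinv_l by lra. nra. }
    nra.
  - destruct (kcoef_neg_summable (alpha - 1)) as [C [HC Hsum]]. { lra. }
    (* Chosen so that the final bound 2 [eta] (C + 1) equals eps. *)
    set (eta := eps / (2 * (C + 1))).
    assert (Heta : 0 < eta) by (apply Rdiv_lt_0_compat; lra).
    destruct (small (eta / (1 + alpha))) as [n0 Hn0]. { apply Rdiv_lt_0_compat; lra. }
    (* [C0] controls all sums of index at most [n0]. It is eventually below [eta] n^alpha, since n
       <= n^alpha. *)
    set (C0 := (2 * K + 1) * kcoef (alpha + 1) n0).
    assert (HC0 : 0 <= C0) by (apply Rmult_le_pos; [lra|apply Rlt_le, kpos]).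
    destruct (INR_unbounded (C0 / eta)) as [n1 Hn1].
    exists (S n1). intros n Hn x. assert (x0 := vnorm_nonneg X x).
    assert (Hn' : 1 <= INR n) by (apply (le_INR 1); lia).
    assert (Hn1' : INR n1 <= INR n) by (apply le_INR; lia).
    assert (pow_ge : INR n <= Rpower (INR n) alpha).
    { rewrite <- (Rpower_1 (INR n)) at 1 by lra. apply Rle_Rpower; lra. }
    assert (C0_le : C0 <= eta * Rpower (INR n) alpha).
    { assert (C0 = C0 / eta * eta) by (field; lra). nra. }
    assert (bound : forall m, (m <= n)%nat ->
      vnorm X (ces X T (alpha - 1) m x) <= 2 * eta * Rpower (INR n) alpha * vnorm X x).
    { intros m Hm.
      assert (pow0 : 0 <= eta * Rpower (INR n) alpha) by (apply Rmult_le_pos; lra).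
      destruct (Nat.le_gt_cases n0 m) as [h|h].
      (* Index 0 is treated apart because the power bound on k^(alpha+1) starts at 1. *)
      - destruct (Nat.eq_dec m 0) as [->|Hm0].
        + eapply Rle_trans. { apply crude. } apply Rmult_le_compat_r; auto.
          assert ((2 * K + 1) * kcoef (alpha + 1) 0 <= C0).
          { apply Rmult_le_compat_l. { lra. } apply kcoef_mono; [lra|lia]. }
          lra.
        + eapply Rle_trans. { apply (Hn0 m x h). } apply Rmult_le_compat_r; auto.
          apply Rle_trans with (eta / (1 + alpha) * ((1 + alpha) * Rpower (INR n) alpha)).
          * apply Rmult_le_compat_l. { apply Rlt_le, Rdiv_lt_0_compat; lra. }
            eapply Rle_trans. { apply kcoef_le_Rpower; [lra|lia]. }
            apply Rmult_le_compat_l. { lra. } apply Rle_Rpower_l. { lra. }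
            split. { apply lt_0_INR; lia. } apply le_INR; lia.
          * apply Rle_trans with (eta * Rpower (INR n) alpha). { right. field. lra. } lra.
      - eapply Rle_trans. { apply crude. } apply Rmult_le_compat_r; auto.
        assert ((2 * K + 1) * kcoef (alpha + 1) m <= C0).
        { apply Rmult_le_compat_l. { lra. } apply kcoef_mono; [lra|lia]. }
        lra. }
    rewrite (opow_ces X T (alpha - 1)). eapply Rle_trans. { apply vnorm_bsum. }
    apply Rle_trans with (bsum (fun j => 2 * eta * Rpower (INR n) alpha * vnorm X x *
        Rabs (kcoef (- (alpha - 1)) j)) (S n)).
    + apply rsum_le. intros j Hj. rewrite vnorm_scal, Cmod_real, Rmult_comm.
      apply Rmult_le_compat_r. { apply Rabs_pos. } apply bound. lia.
    + rewrite rsum_scal. assert (pp : 0 < Rpower (INR n) alpha) by lra.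
      apply Rle_trans with (2 * eta * Rpower (INR n) alpha * vnorm X x * (C + 1)).
      { apply Rmult_le_compat_l.
        - apply Rmult_le_pos; auto. nra.
        - assert (h := Hsum (S n)). lra. }
      right. unfold eta. field. lra.
Qed.
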